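(* Let $\alpha,\beta\in\{+,-\}$ and let $\{G_n\}_{n\in\mathbb{N}}$, $G_n=(V_n,E_n)$, be a sequence of random directed graphs with $|V_n|=n$, and let $e_n$ denote a uniformly sampled edge of $G_n$. Suppose there exist integer valued random variables $\mathcal{D}^\alpha$ and $\mathcal{D}^\beta$ (defined on a common probability space), neither concentrated in a single point, such that for every bounded continuous $h:\mathbb{R}^2\to\mathbb{R}$, $\mathbb{E}\left[h\left(D_n^\alpha(\pi_\ast e_n),D_n^\beta(\pi^\ast e_n)\right)\middle|G_n\right]\to\mathbb{E}\left[h(\mathcal{D}^\alpha,\mathcal{D}^\beta)\right]$ in probability as $n\to\infty$, and suppose $|E_n|\to\infty$ in probability. Put $S_{\mathcal{D}^\alpha}(\mathcal{D}^\alpha)=\mathbb{E}\left[F_{\mathcal{D}^\alpha}(\mathcal{D}^\alpha)F_{\mathcal{D}^\alpha}(\mathcal{D}^\alpha-1)\right]$ and likewise for $\mathcal{D}^\beta$. Then, as $n\to\infty$, (i) $\rho_\alpha^\beta(G_n)\to\rho(\mathcal{D}^\alpha,\mathcal{D}^\beta)$ in probability; (ii) $\overline{\rho}_\alpha^\beta(G_n)\to\dfrac{\rho(\mathcal{D}^\alpha,\mathcal{D}^\beta)}{3\sqrt{S_{\mathcal{D}^\alpha}(\mathcal{D}^\alpha)\,S_{\mathcal{D}^\beta}(\mathcal{D}^\beta)}}$ in probability; (iii) $\tau_\alpha^\beta(G_n)\to\tau(\mathcal{D}^\alpha,\mathcal{D}^\beta)$ in probability. Moreover, (iv) $\lim_{n\to\infty}\mathbb{E}[\rho_\alpha^\beta(G_n)]=\rho(\mathcal{D}^\alpha,\mathcal{D}^\beta)$;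 (v) $\lim_{n\to\infty}\mathbb{E}[\overline{\rho}_\alpha^\beta(G_n)]=\dfrac{\rho(\mathcal{D}^\alpha,\mathcal{D}^\beta)}{3\sqrt{S_{\mathcal{D}^\alpha}(\mathcal{D}^\alpha)\,S_{\mathcal{D}^\beta}(\mathcal{D}^\beta)}}$; (vi) $\lim_{n\to\infty}\mathbb{E}[\tau_\alpha^\beta(G_n)]=\tau(\mathcal{D}^\alpha,\mathcal{D}^\beta)$.
   Context: Random graphs. A random directed (multi-)graph $G=(V,E)$ has a finite vertex set $V$ and, for each $e=(v,w)\in V^2$, a random number $|E(e)|\in\{0,1,2,\dots\}$ of edges from $v$ to $w$; conditioning on $G$ means conditioning on all $|E(e)|$. $|E|=\sum_{e\in V^2}|E(e)|$; sums over $e\in E$ count multiplicity. Out- and in-degree are $D^+(v)=\sum_w|E(v,w)|$, $D^-(v)=\sum_w|E(w,v)|$ (written $D_n^\pm$ for $G_n$). For an edge or pair $e=(v,w)$, $\pi_\ast e=v$ (source) and $\pi^\ast e=w$ (target); $\pi$ stands for either projection, and $D^\alpha\pi e=D^\alpha(\pi e)$. A uniformly sampled edge $e_G$ is a $V^2$-valued random variable with $\mathbb{P}(e_G=e\mid G)=|E(e)|/|E|$. The index $\alpha$ always refers to the source and $\beta$ to the target; $\mathcal{D}^\alpha$ (source) and $\mathcal{D}^\beta$ (target) are two separate random variables even if $\alpha=\beta$. Spearman's rho on $G$, ties resolved at random. Let $U_e,W_e$, $e\in E$, be i.i.d. uniform on $[0,1)$, independent of $G$, and $R^\alpha\pi_\ast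 e=\sum_{f\in E}\mathbf{1}\{D^\alpha\pi_\ast f+U_f\ge D^\alpha\pi_\ast e+U_e\}$, $R^\beta\pi^\ast e=\sum_{f\in E}\mathbf{1}\{D^\beta\pi^\ast f+W_f\ge D^\beta\pi^\ast e+W_e\}$, $$\rho_\alpha^\beta(G)=\frac{12\sum_{e\in E}R^\alpha\pi_\ast e\,R^\beta\pi^\ast e-3|E|(|E|+1)^2}{|E|^3-|E|}.$$ Spearman's rho with average ranks. Let $\overline{R}^\alpha\pi e=\frac12+\sum_{f\in E}\left(\mathbf{1}\{D^\alpha\pi f>D^\alpha\pi e\}+\frac12\mathbf{1}\{D^\alpha\pi f=D^\alpha\pi e\}\right)$ and $$\overline{\rho}_\alpha^\beta(G)=\frac{4\sum_{e\in E}\overline{R}^\alpha\pi_\ast e\,\overline{R}^\beta\pi^\ast e-|E|(|E|+1)^2}{\sqrt{4\sum_{e\in E}(\overline{R}^\alpha\pi_\ast e)^2-|E|(|E|+1)^2}\,\sqrt{4\sum_{e\in E}(\overline{R}^\beta\pi^\ast e)^2-|E|(|E|+1)^2}}.$$ Kendall's tau on $G$. $\tau_\alpha^\beta(G)=\dfrac{2(\mathcal{N}_C(G)-\mathcal{N}_D(G))}{|E|(|E|-1)}$, where $\mathcal{N}_C(G)$ (resp. $\mathcal{N}_D(G)$) is the number of unordered pairs $\{e,f\}$ of edges with $(D^\alpha\pi_\ast e-D^\alpha\pi_\ast f)(D^\beta\pi^\ast e-D^\beta\pi^\ast f)>0$ (resp. $<0$). Each of these three quantities is set to $0$ when its denominator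 vanishes. Limits. For integer valued $X,Y$ with distribution functions $F_X,F_Y$ and joint distribution function $H_{X,Y}$: $\mathcal{F}_X(k)=F_X(k)+F_X(k-1)$, $\mathcal{H}_{X,Y}(k,l)=H_{X,Y}(k,l)+H_{X,Y}(k-1,l)+H_{X,Y}(k,l-1)+H_{X,Y}(k-1,l-1)$, $\rho(X,Y)=3\,\mathbb{E}[\mathcal{F}_X(X)\mathcal{F}_Y(Y)]-3$, $\tau(X,Y)=\mathbb{E}[\mathcal{H}_{X,Y}(X,Y)]-1$. *)

(* Defs.v *)
From HB Require Import structures.
From mathcomp Require Import all_boot all_order all_algebra.
From mathcomp Require Import all_classical all_reals all_analysis.
Set Implicit Arguments.
Unset Strict Implicit.
Unset Printing Implicit Defensive.
Import Order.TTheory GRing.Theory Num.Theory.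
Import numFieldNormedType.Exports.
Local Open Scope classical_set_scope.
Local Open Scope ring_scope.

(** * Directed multigraphs *)

(* [m (v, w)] is the number of edges from [v] to [w]. *)
Definition multigraph (V : finType) := V * V -> nat.

Variant direction := Plus | Minus.

Section Multigraph.
Variables (V : finType) (m : multigraph V).

Definition nb_edges : nat := \sum_(e : V * V) m e.

Definition deg (a : direction) (v : V) : nat :=
  match a with
  | Plus => \sum_(w : V) m (v, w)
  | Minus => \sum_(w : V) m (w, v)
  end.

(* An edge is a pair of vertices together with the index of one of the parallel
   edges between them, so that sums over [edge] count multiplicities. *)
Definition edge : finType := {e : V * V & 'I_(m e)}.

Definition source_deg (a : direction) (e : edge) : nat := deg a (tag e).1.
Definition target_deg (b : direction) (e : edge) : nat := deg b (tag e).2.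

End Multigraph.

(** * Rank correlations

    Division by zero yields zero in MathComp, so each coefficient is zero when
    its denominator vanishes. *)

Section RankCorrelations.
Variables (R : realType) (V : finType) (m : multigraph V).

Section Ranks.
Variables (x : edge m -> nat) (u : edge m -> R) (e : edge m).

(* Decreasing rank of [e], ties being broken by [u]. *)
Definition rank : R := \sum_(f : edge m) ((x e)%:R + u e <= (x f)%:R + u f)%R%:R.

(* Decreasing rank of [e], ties receiving their average rank. *)
Definition avg_rank : R :=
  2^-1 + \sum_(f : edge m) ((x e < x f)%N%:R + 2^-1 * (x f == x e)%:R).

End Ranks.

Variables (a b : direction).
Let E : R := (nb_edges m)%:R.

Definition spearman (u w : edge m -> R) : R :=
  (12 * (\sum_(e : edge m)
           rank (source_deg a (m:=m)) u e * rank (target_deg b (m:=m)) w e)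
   - 3 * E * (E + 1) ^+ 2) / (E ^+ 3 - E).

Definition avg_spearman : R :=
  (4 * (\sum_(e : edge m)
          avg_rank (source_deg a (m:=m)) e * avg_rank (target_deg b (m:=m)) e)
   - E * (E + 1) ^+ 2)
  / (Num.sqrt (4 * (\sum_(e : edge m) avg_rank (source_deg a (m:=m)) e ^+ 2)
               - E * (E + 1) ^+ 2)
     * Num.sqrt (4 * (\sum_(e : edge m) avg_rank (target_deg b (m:=m)) e ^+ 2)
                 - E * (E + 1) ^+ 2)).

(* Product of the differences of the degrees of two edges at both ends. *)
Definition deg_diff_prod (p : edge m * edge m) : int :=
  ((source_deg a p.1)%:Z - (source_deg a p.2)%:Z)
  * ((target_deg b p.1)%:Z - (target_deg b p.2)%:Z).

(* Numbers of unordered pairs [set e; f]; the strict inequalities exclude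
   the degenerate case e = f. *)
Definition nb_concordant : nat :=
  #|[set [set p.1; p.2] | p : edge m * edge m & (0 < deg_diff_prod p)%R]%SET|.
Definition nb_discordant : nat :=
  #|[set [set p.1; p.2] | p : edge m * edge m & (deg_diff_prod p < 0)%R]%SET|.

Definition kendall : R :=
  2 * (nb_concordant%:R - nb_discordant%:R) / (E * (E - 1)).

End RankCorrelations.

(** * Random multigraphs *)

Section RandomGraph.
Variables (d : measure_display) (T : measurableType d) (R : realType).
Variables (P : probability T R) (V : finType) (G : V * V -> {RV P >-> nat}).

Definition realization (t : T) : multigraph V := fun e => G e t.

(* As multigraphs on [V] form a countable set, every set of multigraphs is taken
   to be measurable: this is the sigma-algebra generated by all the [G e]. *)
Definition graph_events : set_system T :=
  preimage_set_system setT realization [set: set (multigraph V)].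

(* The event on which the graph is the same as at [t]. *)
Definition same_graph (t : T) : set T :=
  [set t' | forall e, G e t' = G e t].

(* Since [G] takes countably many values, conditioning on [G] is elementary
   conditioning on the atoms [same_graph t]; the value on atoms of probability
   zero is irrelevant (here it is zero). *)
Definition cond_expectation (X : T -> R) (t : T) : R :=
  fine (\int[P]_(t' in same_graph t) (X t')%:E)%E / fine (P (same_graph t)).

Definition cond_probability (A : set T) (t : T) : R :=
  fine (P (A `&` same_graph t)) / fine (P (same_graph t)).

(* Nothing is required of the conditional law on the event that the graph has no
   edges, where |E(x)| / |E| is undefined. *)
Record uniform_edge (e : T -> V * V) : Prop := {
  uniform_edge_measurable : forall x, measurable (e @^-1` [set x]);
  uniform_edge_law : {ae P, forall t, (0 < nb_edges (realization t))%N ->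
    forall x, cond_probability (e @^-1` [set x]) t
              = (G x t)%:R / (nb_edges (realization t))%:R }
}.

(* The degrees of the source and of the target of the pair of vertices [e]. *)
Definition end_degs (a b : direction) (e : T -> V * V) (t : T) : R * R :=
  ((deg (realization t) a (e t).1)%:R, (deg (realization t) b (e t).2)%:R).

End RandomGraph.

(** * Random tie-breaking *)

Definition mutually_independent (d : measure_display) (T : measurableType d)
    (R : realType) (P : probability T R) (I : eqType) (F : I -> set_system T) :=
  forall (s : seq I) (A : I -> set T), uniq s ->
    (forall i, i \in s -> F i (A i)) ->
    P (\bigcap_(i in [set` s]) A i) = (\prod_(i <- s) P (A i))%E.

Section TieBreaking.
Variables (d : measure_display) (T : measurableType d) (R : realType).
Variables (P : probability T R) (V : finType) (G : V * V -> {RV P >-> nat}).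
Variables (U W : V * V * nat -> {RV P >-> R}).

(* [G] and all tie-breakers, the latter being indexed by all potential edges
   (e, k), where k numbers the parallel edges. *)
Definition tie_breaking_events (i : option (V * V * nat + V * V * nat)) :
    set_system T :=
  match i with
  | None => graph_events G
  | Some (inl j) => preimage_set_system setT (U j) measurable
  | Some (inr j) => preimage_set_system setT (W j) measurable
  end.

(* The library's uniform law on [0, 1] coincides with that on [0, 1[. *)
Record tie_breakers : Prop := {
  tie_breakers_uniform_source : forall j A, measurable A ->
    distribution P (U j) A = uniform_prob (@ltr01 R) A;
  tie_breakers_uniform_target : forall j A, measurable A ->
    distribution P (W j) A = uniform_prob (@ltr01 R) A;
  tie_breakers_independent : mutually_independent P tie_breaking_events
}.

Definition at_edges (X : V * V * nat -> {RV P >-> R}) (t : T)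
    (f : edge (realization G t)) : R :=
  X (tag f, val (tagged f)) t.

Definition random_spearman (a b : direction) (t : T) : R :=
  spearman a b (at_edges U (t := t)) (at_edges W (t := t)).

End TieBreaking.

(** * Convergence in probability

    The n-th variable lives on the n-th probability space: convergence to a
    constant or to infinity does not need a common space. *)

Section ConvergenceInProbability.
Variables (R : realType) (d : nat -> measure_display).
Variables (T : forall n, measurableType (d n)).
Variables (P : forall n, probability (T n) R).

Definition cvg_in_probability (X : forall n, T n -> R) (c : R) : Prop :=
  forall eps : R, 0 < eps ->
    (fun n => P n [set t | eps < `|X n t - c|]) @ \oo --> 0%E.

Definition cvg_pinfty_in_probability (N : forall n, T n -> nat) : Prop :=
  forall K : nat, (fun n => P n [set t | (K < N n t)%N]) @ \oo --> 1%E.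

End ConvergenceInProbability.

(** * Limiting quantities *)

Section Limits.
Variables (d : measure_display) (T : measurableType d) (R : realType).
Variables (P : probability T R).
Implicit Types X Y : {RV P >-> R}.

Definition integer_valued X : Prop := forall t, X t \is a Num.int.

Definition degenerate X : Prop := exists c : R, P (X @^-1` [set c]) = 1%E.

Definition df X (k : R) : R := fine (cdf X k).

Definition joint_df X Y (k l : R) : R :=
  fine (P (X @^-1` `]-oo, k] `&` Y @^-1` `]-oo, l])).

Definition df2 X (k : R) : R := df X k + df X (k - 1).

Definition joint_df4 X Y (k l : R) : R :=
  joint_df X Y k l + joint_df X Y (k - 1) l
  + joint_df X Y k (l - 1) + joint_df X Y (k - 1) (l - 1).

Definition rho X Y : R :=
  3 * fine 'E_P[fun t => df2 X (X t) * df2 Y (Y t)] - 3.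

Definition tau X Y : R :=
  fine 'E_P[fun t => joint_df4 X Y (X t) (Y t)] - 1.

Definition S_moment X : R := fine 'E_P[fun t => df X (X t) * df X (X t - 1)].

End Limits.

(* Main.v *)
Require Import Defs.
From mathcomp Require Import all_boot all_order all_algebra.
From mathcomp Require Import all_classical all_reals all_analysis.
From mathcomp Require Import measurable_realfun ring lra zify.
Set Implicit Arguments.
Unset Strict Implicit.
Unset Printing Implicit Defensive.
Import Order.TTheory GRing.Theory Num.Theory.
Import numFieldNormedType.Exports.
Local Open Scope classical_set_scope.
Local Open Scope ring_scope.

(* Call "empirical law" the law of the pair of degrees at the two ends of a
   uniform edge. Testing the hypothesis against bump functions shows that its
   point masses converge in probability; as the limit is a probability
   distribution on pairs of natural numbers, truncating to a large finite box
   upgrades this to convergence of empirical means of uniformly bounded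
   functions which themselves converge pointwise, such as empirical distribution
   functions. Kendall's tau and Spearman's rho with average ranks are continuous
   functions of such means.
   For randomly broken ties, cut [0, 1) into M intervals of equal length. Given
   the graph, the indicators of "the tie-breakers of e lie in cells i and j" are
   pairwise uncorrelated over the edges e, so by Chebyshev's inequality the pairs
   of cells are asymptotically uniform and independent of the degrees. Ranks are
   then determined up to comparisons inside one cell, an error of order 1 / M.
   Finally, the coefficients are bounded, so their expectations converge too. *)

(** * Rank coefficients of a fixed multigraph *)

(** A randomly broken rank involves the tie-breakers of all edges at once, so Spearman's sum is not
    a mean of uncorrelated terms and Chebyshev's inequality does not apply to it directly. Bins
    reduce it to frequencies of cells within degree classes, which are means over the edges.
    Averaged over the cells, a comparison inside a tie counts one half. Random and average ranks
    therefore share the same limiting covariance, built from [F(k) + F(k - 1)], and differ only in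
    the normalisation; that of average ranks tends to [S_moment] because [F(X) + F(X - 1)] has mean
    1 and second moment [1 + S_moment]. The analytic limits are stated along an arbitrary filter.
    Taking for it [whp], which lives on the disjoint union of the probability spaces, turns ordinary
    limit algebra into statements in probability without any common space. The limiting variables
    are only assumed integer valued, whereas [law] sees natural numbers alone; hence the absence of
    negative mass has to be derived before anything else about the limit. *)

Section Combinatorics.
Context {R : realType}.

(** Half of it is the weight 1, 1/2 or 0 of a comparison with ties, and [le_lt k l - 1] is the sign
    of [k - l]. Its mean over [l] is [F(k) + F(k - 1)], the empirical form of [df2]. *)
Definition le_lt (k l : nat) : R := (l <= k)%N%:R + (l < k)%N%:R.

Lemma le_lt_ge0 k l : 0 <= le_lt k l.
Proof. by rewrite addr_ge0 ?ler0n. Qed.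

Lemma le_lt_le2 k l : le_lt k l <= 2.
Proof. by rewrite /le_lt; do 2 case: (_ <= _)%N => /=; lra. Qed.

Lemma le_ltN k l : le_lt l k = 2 - le_lt k l.
Proof. by rewrite /le_lt; case: ltngtP => _ /=; lra. Qed.

Lemma sumr_cst (E : finType) (c : R) : \sum_(e : E) c = c * #|E|%:R.
Proof. by rewrite sumr_const mulr_natr. Qed.

(** * Identities for finite double sums *)

Section Sums.
Variable (E : finType).
Implicit Types x y : E -> nat.
Local Notation N := (#|E|%:R : R).

(** Exchanging the two indices turns the sum [S] into [2 * N ^+ 2 - S], by [le_ltN]. *)
Lemma sum_le_lt x : \sum_e \sum_f le_lt (x e) (x f) = N ^+ 2.
Proof.
have h : \sum_e \sum_f le_lt (x e) (x f) =
    2 * N ^+ 2 - \sum_e \sum_f le_lt (x e) (x f).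
  rewrite [LHS]exchange_big /=.
  transitivity (\sum_(j : E) \sum_(i : E) (2 - le_lt (x j) (x i))).
    by apply: eq_bigr => e _; apply: eq_bigr => f _; exact: le_ltN.
  under [LHS]eq_bigr do rewrite sumrB sumr_cst.
  by rewrite sumrB sumr_cst expr2 mulrA.
lra.
Qed.

Lemma sum_mul_le_lt x y :
  \sum_e \sum_f (le_lt (x e) (x f) - 1) * (le_lt (y e) (y f) - 1) =
  \sum_e \sum_f le_lt (x e) (x f) * le_lt (y e) (y f) - N ^+ 2.
Proof.
transitivity (\sum_e \sum_f (le_lt (x e) (x f) * le_lt (y e) (y f)
    - (le_lt (x e) (x f) + le_lt (y e) (y f) - 1))).
  by apply: eq_bigr => e _; apply: eq_bigr => f _; ring.
under [LHS]eq_bigr do rewrite sumrB sumrB big_split/= sumr_cst.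
rewrite sumrB sumrB big_split/= sumr_cst !sum_le_lt expr2.
ring.
Qed.

Lemma Cauchy_Schwarz_sum (f g : E -> R) :
  `|\sum_e f e * g e| <=
  Num.sqrt (\sum_e f e ^+ 2) * Num.sqrt (\sum_e g e ^+ 2).
Proof.
have f0 : 0 <= \sum_e f e ^+ 2 by apply: sumr_ge0 => e _; exact: sqr_ge0.
have g0 : 0 <= \sum_e g e ^+ 2 by apply: sumr_ge0 => e _; exact: sqr_ge0.
rewrite -sqrtrM// -sqrtr_sqr ler_sqrt; last exact: mulr_ge0.
(* Lagrange's identity: this double sum is twice the gap in the squared inequality. *)
have : 0 <= \sum_e \sum_e' (f e * g e' - f e' * g e) ^+ 2.
  by apply: sumr_ge0 => e _; apply: sumr_ge0 => e' _; exact: sqr_ge0.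
suff -> : \sum_e \sum_e' (f e * g e' - f e' * g e) ^+ 2 =
  2 * ((\sum_e f e ^+ 2) * (\sum_e g e ^+ 2) - (\sum_e f e * g e) ^+ 2).
  by rewrite pmulr_rge0// subr_ge0.
transitivity (\sum_e \sum_e' ((f e ^+ 2 * g e' ^+ 2 + g e ^+ 2 * f e' ^+ 2)
    - 2 * (f e * g e) * (f e' * g e'))).
  by apply: eq_bigr => e _; apply: eq_bigr => e' _; ring.
under [LHS]eq_bigr do rewrite sumrB big_split/= -!mulr_sumr.
rewrite sumrB big_split/= -!mulr_suml -mulr_sumr; ring.
Qed.

(** Forgetting the order is two-to-one on a symmetric relation that avoids the diagonal; the count
    is done fibre by fibre. *)
Lemma card_unordered_pairs (D : {pred E * E}) :
  (forall e f, D (e, f) -> D (f, e) /\ e != f) ->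
  (2 * #|[set [set p.1; p.2] | p : E * E & D p]%SET|)%N = #|D|.
Proof.
move=> Dsym; rewrite -(cardsE D).
set S := imset _ _; set D' := [set p in D]%SET.
have DS p : p \in D' -> [set p.1; p.2]%SET \in S.
  by rewrite inE => Dp; apply/imsetP; exists p; rewrite ?inE.
transitivity (\sum_(p in D') 1)%N; last by rewrite sum1_card.
rewrite (partition_big (fun p => [set p.1; p.2]%SET) (mem S))//=.
rewrite mulnC -sum_nat_const; apply: eq_bigr.
move=> A /imsetP[[e f] /=]; rewrite inE => Def ->.
have {}Def : D (e, f) by [].
have [Dfe ef] := Dsym _ _ Def.
rewrite sum1dep_card; transitivity #|[set (e, f); (f, e)]%SET|.
  by rewrite cards2 xpair_eqE negb_and ef.
apply: eq_card => -[e' f']; rewrite !inE /=; apply/orP/andP.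
- move=> [] /eqP[-> ->]; first by split.
  by split; [exact: Dfe|rewrite /= finset.setUC].
- move=> [De'f' /eqP/setP h].
  have [_ ef'] := Dsym _ _ De'f'.
  have := h e'; have := h f'; rewrite !inE !eqxx/= orbT => /esym h1 /esym h2.
  move: h1 h2 ef' => /orP[]/eqP-> /orP[]/eqP->; rewrite ?eqxx//=; auto.
Qed.

End Sums.

Section Coefficients.
Variables (V : finType) (m : multigraph V).
Local Notation N := (#|edge m|%:R : R).

Lemma nb_edgesE : nb_edges m = #|edge m|.
Proof.
rewrite card_tagged sumnE big_map big_enum/= /nb_edges.
by apply: eq_bigr => e _; rewrite card_ord.
Qed.

(** Each [f], tied or not, contributes [1 - le_lt (x e) (x f) / 2]; the ones add up to [N]. *)
Lemma avg_rankE (x : edge m -> nat) e :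
  avg_rank R x e = 2^-1 + N - 2^-1 * \sum_f le_lt (x e) (x f).
Proof.
rewrite /avg_rank -addrA; congr (_ + _).
rewrite mulr_sumr -[N]mulr1 mulr_natl -sumr_const -sumrB.
apply: eq_bigr => f _; rewrite /le_lt eq_sym; case: ltngtP => _ /=; lra.
Qed.

Lemma sum_avg_rank (x : edge m -> nat) :
  \sum_e avg_rank R x e = N * (N + 1) / 2.
Proof.
under eq_bigr do rewrite avg_rankE.
rewrite sumrB -mulr_sumr sum_le_lt sumr_cst; by field.
Qed.

(** The average ranks have mean [(N + 1) / 2] whatever the ties, by [sum_avg_rank]. Numerator and
    radicands of [avg_spearman] are thus covariance and variances up to one common factor: the
    coefficient is Pearson's correlation of the average ranks. *)
Lemma sum_avg_rank_centered (x y : edge m -> nat) :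
  4 * (\sum_e avg_rank R x e * avg_rank R y e) - N * (N + 1) ^+ 2 =
  4 * \sum_e (avg_rank R x e - (N + 1) / 2) * (avg_rank R y e - (N + 1) / 2).
Proof.
transitivity (4 * \sum_e (avg_rank R x e * avg_rank R y e
   - ((N + 1) / 2 * avg_rank R x e + (N + 1) / 2 * avg_rank R y e
      - (N + 1) ^+ 2 / 4))); last first.
  by congr (_ * _); apply: eq_bigr => e _; by field.
rewrite sumrB sumrB big_split/= -!mulr_sumr !sum_avg_rank sumr_cst.
by field.
Qed.

Lemma norm_avg_spearman_le1 a b : `|avg_spearman R m a b| <= 1.
Proof.
rewrite /avg_spearman nb_edgesE.
rewrite -[X in Num.sqrt X * _]/(4 * (\sum_e avg_rank R _ e ^+ 2) - _).
have sq (x : edge m -> nat) : 4 * (\sum_e avg_rank R x e ^+ 2) - N * (N + 1) ^+ 2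
    = 4 * \sum_e (avg_rank R x e - (N + 1) / 2) ^+ 2.
  by under eq_bigr do rewrite expr2; rewrite sum_avg_rank_centered.
rewrite sum_avg_rank_centered !sq normrM normfV.
have s0 (x : edge m -> nat) : 0 <= \sum_e (avg_rank R x e - (N + 1) / 2) ^+ 2.
  by apply: sumr_ge0 => e _; exact: sqr_ge0.
set u := _ * Num.sqrt _.
have u0 : 0 <= u by rewrite mulr_ge0// sqrtr_ge0.
(* A vanishing denominator makes the coefficient zero; otherwise Cauchy-Schwarz applies. *)
rewrite (ger0_norm u0); have [->|u_neq0] := eqVneq u 0.
  by rewrite invr0 mulr0.
rewrite ler_pdivrMr ?mul1r; last by rewrite lt_neqAle eq_sym u_neq0.
rewrite /u !sqrtrM// mulrACA -expr2 sqr_sqrtr// normrM ger0_norm//.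
by rewrite ler_wpM2l// Cauchy_Schwarz_sum.
Qed.

(** Both sides are the product of the signs of the two degree differences. *)
Lemma deg_diff_prodE a b (p : edge m * edge m) :
  (0 < deg_diff_prod a b p :> int)%:R - (deg_diff_prod a b p < 0 :> int)%:R =
  (le_lt (source_deg a p.1) (source_deg (m := m) a p.2) - 1) *
  (le_lt (target_deg b p.1) (target_deg (m := m) b p.2) - 1) :> R.
Proof.
rewrite /deg_diff_prod /le_lt.
move: (source_deg a p.1) (source_deg a p.2) => x x'.
move: (target_deg b p.1) (target_deg b p.2) => y y'.
case: (ltngtP x x') => hx; case: (ltngtP y y') => hy;
  rewrite ?hx ?hy ?subrr ?mulr0 ?mul0r ?ltxx ?subr0 /=; try lra.
- have -> : (0 < (x%:Z - x'%:Z) * (y%:Z - y'%:Z)) = true by nia.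
  have -> : ((x%:Z - x'%:Z) * (y%:Z - y'%:Z) < 0) = false by nia.
  by rewrite /=; lra.
- have -> : (0 < (x%:Z - x'%:Z) * (y%:Z - y'%:Z)) = false by nia.
  have -> : ((x%:Z - x'%:Z) * (y%:Z - y'%:Z) < 0) = true by nia.
  by rewrite /=; lra.
- have -> : (0 < (x%:Z - x'%:Z) * (y%:Z - y'%:Z)) = false by nia.
  have -> : ((x%:Z - x'%:Z) * (y%:Z - y'%:Z) < 0) = true by nia.
  by rewrite /=; lra.
- have -> : (0 < (x%:Z - x'%:Z) * (y%:Z - y'%:Z)) = true by nia.
  have -> : ((x%:Z - x'%:Z) * (y%:Z - y'%:Z) < 0) = false by nia.
  by rewrite /=; lra.
Qed.

Lemma deg_diff_prod_sym a b e f :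
  deg_diff_prod (m := m) a b (e, f) = deg_diff_prod a b (f, e).
Proof. by rewrite /deg_diff_prod /=; ring. Qed.

Lemma concordanceE a b :
  2 * ((nb_concordant m a b)%:R - (nb_discordant m a b)%:R) =
  \sum_(e : edge m) \sum_(f : edge m)
    le_lt (source_deg a e) (source_deg a f) *
                le_lt (target_deg b e) (target_deg b f) - N ^+ 2 :> R.
Proof.
have card (D : {pred edge m * edge m}) :
  (forall e f, D (e, f) -> D (f, e) /\ e != f) ->
  2 * #|[set [set p.1; p.2] | p : edge m * edge m & D p]%SET|%:R =
  \sum_p (D p)%:R :> R.
  move=> /card_unordered_pairs; rewrite -natrM => ->.
  rewrite -sum1_card natr_sum big_mkcond/=; apply: eq_bigr => p _.
  by rewrite -topredE/=; case: (D p).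
rewrite mulrBr !card; last 2 first.
- move=> e f h; split; first by rewrite deg_diff_prod_sym.
  by apply: contraTneq h => ->; rewrite /deg_diff_prod/= !subrr mul0r ltxx.
- move=> e f h; split; first by rewrite deg_diff_prod_sym.
  by apply: contraTneq h => ->; rewrite /deg_diff_prod/= !subrr mul0r ltxx.
rewrite -sumrB -sum_mul_le_lt pair_big/=.
by apply: eq_bigr => p _; exact: deg_diff_prodE.
Qed.

Lemma kendallE a b :
  kendall R m a b =
  (\sum_(e : edge m) \sum_(f : edge m)
    le_lt (source_deg a e) (source_deg a f) *
     le_lt (target_deg b e) (target_deg b f) - N ^+ 2) / (N * (N - 1)).
Proof. by rewrite /kendall concordanceE nb_edgesE. Qed.

(** A crude constant, as only boundedness matters for the expectations. For [N >= 2] the numerator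
    lies between [- N ^+ 2] and [3 * N ^+ 2], and [N <= 2 * (N - 1)]; for smaller [N] the
    denominator is zero. *)
Lemma norm_kendall_le a b : `|kendall R m a b| <= 6.
Proof.
rewrite kendallE.
have [Nle1|N2] := leqP #|edge m| 1.
  suff -> : N * (N - 1) = 0 by rewrite invr0 mulr0 normr0.
  by move: Nle1; case: #|_| => [|[|]]// _; rewrite ?mul0r ?subrr ?mulr0.
have {}N2 : 2 <= N by rewrite ler_nat.
rewrite normrM normfV [X in _ / X]ger0_norm; last by nra.
rewrite ler_pdivrMr; last by nra.
set S := \sum_e _.
have S0 : 0 <= S.
  by do 2 (apply: sumr_ge0 => ? _); rewrite mulr_ge0// le_lt_ge0.
have S4 : S <= 4 * N ^+ 2.
  apply: (@le_trans _ _ (\sum_(e : edge m) \sum_(f : edge m) (2 * 2))).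
    apply: ler_sum => e _; apply: ler_sum => f _.
    by rewrite ler_pM ?le_lt_ge0 ?le_lt_le2.
  by rewrite !sumr_cst; nra.
have N2' : 0 <= N * (N - 2) by rewrite mulr_ge0 ?subr_ge0.
move: N2' S0 S4; rewrite mulrBr -expr2 => *.
by rewrite ler_norml mulrBr -expr2; apply/andP; split; lra.
Qed.

Lemma rank_ge0 (x : edge m -> nat) (u : edge m -> R) e : 0 <= rank x u e.
Proof. by apply: sumr_ge0 => f _; rewrite ler0n. Qed.

Lemma rank_le (x : edge m -> nat) (u : edge m -> R) e : rank x u e <= N.
Proof.
rewrite -[N]mulr1 mulr_natl -sumr_const.
by apply: ler_sum => f _; rewrite lern1 leq_b1.
Qed.

(** The tie-breakers are arbitrary and may coincide, so the proof relies on [0 <= rank <= N]. For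
    [N >= 2] the two terms of the numerator are at most [12 * N ^+ 3] and [27 / 4 * N ^+ 3], and the
    denominator is at least [3 / 4 * N ^+ 3], whence 25 = 16 + 9. *)
Lemma norm_spearman_le a b (u w : edge m -> R) : `|spearman a b u w| <= 25.
Proof.
rewrite /spearman nb_edgesE.
have [Nle1|N2] := leqP #|edge m| 1.
  suff -> : N ^+ 3 - N = 0 by rewrite invr0 mulr0 normr0.
  by move: Nle1; case: #|_| => [|[|]]// _; rewrite ?expr0n ?expr1n ?subrr.
have {}N2 : 2 <= N by rewrite ler_nat.
have N3 : N ^+ 3 - N >= 3 / 4 * N ^+ 3.
  rewrite -subr_ge0 (_ : _ - _ = N * (N ^+ 2 / 4 - 1)); last by field.
  by rewrite mulr_ge0//; nra.
have N30 : N ^+ 3 >= 8.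
  by rewrite (_ : 8 = 2 ^+ 3); [rewrite lerXn2r//= nnegrE; lra|ring].
rewrite normrM normfV [X in _ / X]ger0_norm; last by lra.
rewrite ler_pdivrMr; last by lra.
set S := \sum_e _.
have S0 : 0 <= S by apply: sumr_ge0 => ? _; rewrite mulr_ge0// rank_ge0.
have S4 : S <= N ^+ 3.
  apply: (@le_trans _ _ (\sum_(e : edge m) N * N)).
    by apply: ler_sum => e _; rewrite ler_pM ?rank_ge0 ?rank_le.
  by rewrite sumr_cst !exprS expr0 mulr1 mulrA.
have h : N * (N + 1) ^+ 2 <= 9 / 4 * N ^+ 3.
  rewrite -subr_ge0 (_ : _ - _ = N * (9 / 4 * N ^+ 2 - (N + 1) ^+ 2)); last by field.
  rewrite mulr_ge0//; nra.
have h0 : 0 <= N * (N + 1) ^+ 2 by rewrite mulr_ge0// sqr_ge0.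
rewrite -mulrA; move: h h0 N3 N30 S0 S4; set Q := N * _; set C := N ^+ 3 => *.
rewrite ler_norml; apply/andP; split; lra.
Qed.

End Coefficients.
End Combinatorics.

(** * Means over the edges and their limits *)

Section EmpiricalMean.
Context {R : realType} {E : finType}.
Implicit Types f g : E -> R.

Definition emp f : R := (\sum_e f e) / #|E|%:R.

Lemma emp_ge0 f : (forall e, 0 <= f e) -> 0 <= emp f.
Proof. by move=> f0; rewrite /emp divr_ge0// sumr_ge0. Qed.

Lemma ler_emp f g : (forall e, f e <= g e) -> emp f <= emp g.
Proof. by move=> fg; rewrite /emp ler_wpM2r ?invr_ge0// ler_sum. Qed.

Lemma norm_emp_le f : `|emp f| <= emp (fun e => `|f e|).
Proof.
rewrite /emp normrM normfV (ger0_norm (ler0n _ _)) ler_wpM2r ?invr_ge0//.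
exact: ler_norm_sum.
Qed.

Lemma empD f g : emp (fun e => f e + g e) = emp f + emp g.
Proof. by rewrite /emp big_split mulrDl. Qed.

Lemma empB f g : emp (fun e => f e - g e) = emp f - emp g.
Proof. by rewrite /emp sumrB mulrBl. Qed.

Lemma empZ c f : emp (fun e => c * f e) = c * emp f.
Proof. by rewrite /emp -mulr_sumr mulrA. Qed.

Lemma emp_sum (I : finType) (f : I -> E -> R) :
  emp (fun e => \sum_i f i e) = \sum_i emp (f i).
Proof. by rewrite /emp exchange_big mulr_suml. Qed.

(** Only an inequality, because a mean over the empty type is 0. *)
Lemma emp1_le1 : emp (fun=> 1) <= 1.
Proof.
rewrite /emp sumr_cst mul1r; have [->|] := eqVneq (#|E|%:R : R) 0.
  by rewrite mul0r.
by move=> E0; rewrite divff.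
Qed.

Lemma norm_emp_bound c f : (forall e, `|f e| <= c) -> 0 <= c -> `|emp f| <= c.
Proof.
move=> fc c0; rewrite (le_trans (norm_emp_le _))//.
rewrite (@le_trans _ _ (emp (fun=> c * 1)))//.
  by apply: ler_emp => e; rewrite mulr1.
by rewrite empZ ler_piMr// emp1_le1.
Qed.

End EmpiricalMean.

(** A double series is understood as the limit of its sums over growing squares. *)
Definition box {R : realType} (g : nat -> nat -> R) (K : nat) : R :=
  \sum_(k < K) \sum_(l < K) g k l.

Lemma sum_indic {R : realType} (h : nat -> R) (n K : nat) :
  \sum_(k < K) (n == k)%:R * h k = (n < K)%N%:R * h n.
Proof.
case: ltnP => nK; last first.
  rewrite mul0r big1// => k _.
  rewrite (_ : (n == k) = false) ?mul0r//; apply/negbTE.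
  by rewrite neq_ltn (leq_trans (ltn_ord k) nK) orbT.
rewrite (bigD1 (Ordinal nK))//= eqxx big1 ?addr0// => k kn.
by rewrite (_ : (n == k) = false) ?mul0r//; apply/negbTE; rewrite eq_sym.
Qed.

Lemma box_indic {R : realType} (g : nat -> nat -> R) (K i j : nat) :
  box (fun k l => ((i == k) && (j == l))%:R * g k l) K =
  ((i < K) && (j < K))%N%:R * g i j.
Proof.
rewrite /box; transitivity (\sum_(k < K) (i == k)%:R * ((j < K)%N%:R * g k j)).
  apply: eq_bigr => k _; rewrite -(sum_indic (g k)) mulr_sumr.
  by apply: eq_bigr => l _; rewrite -mulnb natrM mulrA.
by rewrite (sum_indic (fun k => (j < K)%N%:R * g k j)) -mulnb natrM mulrA.
Qed.

Lemma cvg_sum {R : realType} {Z I : Type} (F : set_system Z) {FF : Filter F}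
    (r : seq I) (Q : pred I) (f : I -> Z -> R) (l : I -> R) :
  (forall i, Q i -> f i @ F --> l i) ->
  (fun z => \sum_(i <- r | Q i) f i z) @ F --> \sum_(i <- r | Q i) l i.
Proof. by move=> fl; apply: cvg_big => //; exact: add_continuous. Qed.

Lemma near_cvg {R : realType} {Z : Type} (F : set_system Z) {FF : Filter F}
    (f g : Z -> R) (l : R) :
  (\forall z \near F, f z = g z) -> f @ F --> l -> g @ F --> l.
Proof. by move=> fg; apply: cvg_trans; exact: near_eq_cvg. Qed.

(** * Means of functions of the degrees, by truncation to a box *)

Section EmpiricalLimit.
Context {R : realType} {Z : Type} (F : set_system Z) {FF : Filter F}.
Variables (E : Z -> finType) (x y : forall z, E z -> nat).
Variable p : nat -> nat -> R.
Hypothesis p_mass : box p @ \oo --> (1 : R).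
Hypothesis p_cvg : forall k l, (fun z =>
  emp (fun e : E z => ((x e == k) && (y e == l))%:R : R)) @ F --> p k l.

(* Both the weighted mean and its limit are within C times the mass left outside
   a large box of the corresponding sums over that box. *)
Lemma weighted_emp_cvg (kappa v C : R) (w : forall z, E z -> R)
    (phi_ : Z -> nat -> nat -> R) (phi : nat -> nat -> R) :
  (forall z e, 0 <= w z e <= 1) ->
  (forall k l, (fun z =>
     emp (fun e => w z e * ((x e == k) && (y e == l))%:R)) @ F -->
     kappa * p k l) ->
  (forall z k l, `|phi_ z k l| <= C) ->
  (forall k l, (fun z => phi_ z k l) @ F --> phi k l) ->
  box (fun k l => p k l * phi k l) @ \oo --> v ->
  (fun z => emp (fun e => w z e * phi_ z (x e) (y e))) @ F --> kappa * v.
Proof.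
move=> w01 w_cvg phiC phi_cvg box_cvg.
pose h z K := box (fun k l =>
  emp (fun e => w z e * ((x e == k) && (y e == l))%:R) * phi_ z k l) K.
pose t z K := C * (1 - box (fun k l =>
  emp (fun e : E z => ((x e == k) && (y e == l))%:R : R)) K).
have hE z K : h z K = emp (fun e : E z =>
    w z e * (((x e < K) && (y e < K))%N%:R * phi_ z (x e) (y e))).
  transitivity (emp (fun e => w z e * box (fun k l =>
      ((x e == k) && (y e == l))%:R * phi_ z k l) K)); last first.
    by congr emp; apply/funext => e; rewrite box_indic.
  rewrite /h /box.
  under [in RHS]eq_fun do rewrite mulr_sumr.
  rewrite emp_sum; apply: eq_bigr => k _.
  under [in RHS]eq_fun do rewrite mulr_sumr.
  rewrite emp_sum; apply: eq_bigr => l _.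
  by rewrite mulrC -empZ; congr emp; apply/funext => e; ring.
have tE z K : 1 - box (fun k l =>
    emp (fun e : E z => ((x e == k) && (y e == l))%:R : R)) K =
    1 - emp (fun e : E z => ((x e < K) && (y e < K))%N%:R : R) :> R.
  congr (_ - _).
  transitivity (emp (fun e : E z => box (fun k l =>
      ((x e == k) && (y e == l))%:R * 1 : R) K)); last first.
    by congr emp; apply/funext => e; rewrite box_indic mulr1.
  rewrite /box emp_sum; apply: eq_bigr => k _.
  rewrite emp_sum; apply: eq_bigr => l _.
  by congr emp; apply/funext => e; rewrite mulr1.
have tail z K : `|emp (fun e => w z e * phi_ z (x e) (y e)) - h z K| <= t z K.
  have C0 : 0 <= C by apply: le_trans (phiC z 0 0)%N; rewrite normr_ge0.
  rewrite hE -empB /t tE.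
  (* The mean of [1 - indicator] is merely at most 1 minus the mean of the indicator: over the empty
     type these are 0 and 1. *)
  apply: (@le_trans _ _ (C * emp (fun e : E z =>
      1 - ((x e < K) && (y e < K))%N%:R : R))); last first.
    by rewrite ler_wpM2l// empB lerB// emp1_le1.
  rewrite (le_trans (norm_emp_le _))// -empZ; apply: ler_emp => e.
  have /andP[w0 w1] := w01 z e.
  case: (_ && _); rewrite ?mul1r ?subrr ?mulr0 ?normr0//.
  rewrite mul0r mulr0 !subr0 mulr1 normrM ger0_norm//.
  by rewrite (le_trans (ler_piMl _ w1))// normr_ge0.
have h_cvg K : h ^~ K @ F --> kappa * box (fun k l => p k l * phi k l) K.
  rewrite /h /box mulr_sumr; apply: cvg_sum => k _.
  rewrite mulr_sumr; apply: cvg_sum => l _.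
  by rewrite mulrA; apply: cvgM.
have t_cvg K : t ^~ K @ F --> C * (1 - box p K).
  apply: cvgM; first exact: cvg_cst.
  apply: cvgB; first exact: cvg_cst.
  by do 2 (apply: cvg_sum => ? _).
apply/cvgrPdist_le => eps eps0.
have eps4 : 0 < eps / 4 by rewrite divr_gt0.
(* [K] is fixed before [z]: it makes the mass outside the box small for the limit law, and the
   limits of [h] and [t] at this [K] transfer that to [z]. This makes four errors of [eps / 4]. *)
have [K [K1 K2]] : exists K,
    `|kappa * v - kappa * box (fun k l => p k l * phi k l) K| <= eps / 4 /\
    C * (1 - box p K) <= eps / 4.
  have c1 : (fun K => kappa * box (fun k l => p k l * phi k l) K) @ \oo --> kappa * v.
    by apply: cvgM => //; exact: cvg_cst.
  have c2 : (fun K => C * (1 - box p K)) @ \oo --> C * (1 - 1).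
    apply: cvgM; first exact: cvg_cst.
    by apply: cvgB => //; exact: cvg_cst.
  have /cvgrPdist_le/(_ _ eps4) n1 := c1.
  have /cvgrPdist_le/(_ _ eps4) n2 := c2.
  have [K [h1 h2]] := filter_ex (filterI n1 n2).
  exists K; split => //; move: h2; rewrite subrr mulr0 sub0r normrN.
  by move=> /(le_trans (ler_norm _)).
have /cvgrPdist_le/(_ _ eps4) := h_cvg K.
have /cvgrPdist_le/(_ _ eps4) := t_cvg K.
apply: filterS2 => z /=; move: (tail z K) K1 K2.
set a := emp _; set b := h z K; set c := t z K; set d := C * (1 - _).
set e := kappa * v; set g := kappa * box _ _.
rewrite !ler_norml => /andP[? ?] /andP[? ?] ? /andP[? ?] /andP[? ?].
apply/andP; split; lra.
Qed.

(** The case of weight 1. Since [phi_] may vary with [z], it accepts empirical distribution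
    functions. *)
Lemma emp_cvg (v C : R)
    (phi_ : Z -> nat -> nat -> R) (phi : nat -> nat -> R) :
  (forall z k l, `|phi_ z k l| <= C) ->
  (forall k l, (fun z => phi_ z k l) @ F --> phi k l) ->
  box (fun k l => p k l * phi k l) @ \oo --> v ->
  (fun z => emp (fun e : E z => phi_ z (x e) (y e))) @ F --> v.
Proof.
move=> phiC phi_cvg box_cvg.
have := @weighted_emp_cvg 1 v C (fun _ _ => 1) phi_ phi.
rewrite mul1r => h; under eq_fun do under eq_fun do rewrite -[phi_ _ _ _]mul1r.
apply: h => //; first by move=> z e; apply/andP; split.
by move=> k l; rewrite mul1r; under eq_fun do under eq_fun do rewrite mul1r;
  exact: p_cvg.
Qed.

End EmpiricalLimit.

Section Box.
Context {R : realType}.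
Implicit Types f g : nat -> nat -> R.

Lemma boxD f g K : box (fun k l => f k l + g k l) K = box f K + box g K.
Proof. by rewrite /box -big_split; apply: eq_bigr => k _; rewrite big_split. Qed.

Lemma boxZ c f K : box (fun k l => c * f k l) K = c * box f K.
Proof. by rewrite /box mulr_sumr; apply: eq_bigr => k _; rewrite mulr_sumr. Qed.

Lemma eq_box f g : (forall k l, f k l = g k l) -> box f = box g.
Proof.
move=> fg; apply/funext => K.
by apply: eq_bigr => k _; apply: eq_bigr => l _; exact: fg.
Qed.

Lemma box_cvgD f g (a b : R) : box f @ \oo --> a -> box g @ \oo --> b ->
  box (fun k l => f k l + g k l) @ \oo --> a + b.
Proof.
move=> fa gb; have -> : box (fun k l => f k l + g k l) = box f \+ box g.
  by apply/funext => K; exact: boxD.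
exact: cvgD.
Qed.

Lemma box_cvgZ c f (a : R) : box f @ \oo --> a ->
  box (fun k l => c * f k l) @ \oo --> c * a.
Proof.
move=> fa; have -> : box (fun k l => c * f k l) = cst c \* box f.
  by apply/funext => K; exact: boxZ.
by apply: cvgM => //; exact: cvg_cst.
Qed.

(** Ranks decrease where distribution functions increase, so [2 - s] and [2 - t] occur. As [p] has
    mass 1 and [s], [t] have mean 1, the terms [4 - 2 - 2] of the expanded product cancel. *)
Lemma box_cvg_rank (p s t : nat -> nat -> R) (c v : R) :
  box p @ \oo --> (1 : R) ->
  box (fun k l => p k l * s k l) @ \oo --> (1 : R) ->
  box (fun k l => p k l * t k l) @ \oo --> (1 : R) ->
  box (fun k l => p k l * (s k l * t k l)) @ \oo --> v ->
  box (fun k l => p k l * ((2 - s k l) * (2 - t k l))) @ \oo --> v.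
Proof.
move=> p1 s1 t1 v1.
have -> : box (fun k l => p k l * ((2 - s k l) * (2 - t k l))) =
  box (fun k l => p k l * (s k l * t k l) + (4 * p k l +
    (- 2 * (p k l * s k l) + - 2 * (p k l * t k l)))).
  by apply: eq_box => k l; ring.
rewrite [X in _ --> X](_ : v = v + (4 * 1 + (- 2 * 1 + - 2 * 1))); last by ring.
by do 3 (apply: box_cvgD => //; try exact: box_cvgZ).
Qed.

End Box.

(** * Kendall's tau and Spearman's rho with average ranks along a filter *)

Section CoefficientLimits.
Context {R : realType} {Z : Type} (F : set_system Z) {FF : Filter F}.
Variables (V : Z -> finType) (m : forall z, multigraph (V z)).
Arguments m : clear implicits.
Local Notation N z := (#|edge (m z)|%:R : R).
Hypothesis N_cvg : (fun z => (N z)^-1) @ F --> (0 : R).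
Hypothesis N_gt0 : \forall z \near F, 0 < N z.
Variable p : nat -> nat -> R.
Hypothesis p_mass : box p @ \oo --> (1 : R).

Let invN_le1 z : 0 <= (N z)^-1 <= 1.
Proof.
rewrite invr_ge0 ler0n; case: #|edge (m z)| => [|n]; first by rewrite invr0 ler01.
by rewrite invf_le1// ler1n.
Qed.

Section Degrees.
Variables x y : forall z, edge (m z) -> nat.
Hypothesis p_cvg : forall k l, (fun z =>
  emp (fun e : edge (m z) => ((x e == k) && (y e == l))%:R : R)) @ F --> p k l.

(** The normalised covariance of average ranks, with [s] and [t] the empirical versions of [df2].
    The bound 9 in the proof is [3 * 3], from [(N z)^-1 <= 1] and [0 <= 2 - s <= 2]. *)
Lemma rank_mean_cvg (s t : Z -> nat -> nat -> R) (s' t' : nat -> nat -> R)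
    (v : R) :
  (forall z k l, 0 <= s z k l <= 2) -> (forall z k l, 0 <= t z k l <= 2) ->
  (forall k l, (fun z => s z k l) @ F --> s' k l) ->
  (forall k l, (fun z => t z k l) @ F --> t' k l) ->
  box (fun k l => p k l * s' k l) @ \oo --> (1 : R) ->
  box (fun k l => p k l * t' k l) @ \oo --> (1 : R) ->
  box (fun k l => p k l * (s' k l * t' k l)) @ \oo --> v ->
  (fun z => emp (fun e : edge (m z) => ((N z)^-1 + 2 - s z (x e) (y e)) *
                          ((N z)^-1 + 2 - t z (x e) (y e)))
            - (1 + (N z)^-1) ^+ 2) @ F --> v - 1.
Proof.
move=> s02 t02 s_cvg t_cvg s1 t1 v1.
apply: cvgB; last first.
  rewrite [X in _ --> X](_ : 1 = (1 + 0) * (1 + 0)); last by ring.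
  under eq_fun do rewrite expr2.
  by apply: cvgM; apply: cvgD => //; exact: cvg_cst.
apply: (@emp_cvg _ _ F _ _ x y p p_mass p_cvg v 9
  (fun z k l => ((N z)^-1 + 2 - s z k l) * ((N z)^-1 + 2 - t z k l))
  (fun k l => (0 + 2 - s' k l) * (0 + 2 - t' k l))).
- move=> z k l; have := invN_le1 z; have := s02 z k l; have := t02 z k l.
  move: (_^-1) (s z k l) (t z k l) => a b c h1 h2 h3.
  rewrite normrM (_ : 9 = 3 * 3)//; last by ring.
  by apply: ler_pM => //; rewrite ler_norml; apply/andP; split; lra.
- move=> k l; apply: cvgM; (apply: cvgB; last by []);
  by apply: cvgD => //; exact: cvg_cst.
- rewrite (_ : box _ = box (fun k l => p k l * ((2 - s' k l) * (2 - t' k l)))).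
    exact: box_cvg_rank.
  by apply: eq_box => k l; rewrite add0r.
Qed.


Lemma avg_rank_emp z (h : edge (m z) -> nat) e : 0 < N z ->
  avg_rank R h e =
  N z / 2 * ((N z)^-1 + 2 - emp (fun f => le_lt (h e) (h f))).
Proof. by move=> N0; rewrite avg_rankE /emp; field; rewrite gt_eqF. Qed.

Lemma sum_avg_rank_emp z (g h : edge (m z) -> nat) : 0 < N z ->
  4 * (\sum_e avg_rank R g e * avg_rank R h e) - N z * (N z + 1) ^+ 2 =
  N z ^+ 3 * (emp (fun e => ((N z)^-1 + 2 - emp (fun f => le_lt (g e) (g f))) *
                            ((N z)^-1 + 2 - emp (fun f => le_lt (h e) (h f))))
              - (1 + (N z)^-1) ^+ 2).
Proof.
move=> N0; under eq_bigr do rewrite !avg_rank_emp// mulrACA.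
rewrite -mulr_sumr [in RHS]/emp; set S := \sum_e _; field.
by rewrite gt_eqF.
Qed.

(** The factor [N z ^+ 3] of the numerator cancels against its two square roots below. *)
Lemma avg_spearman_emp z a b (A := fun (g h : edge (m z) -> nat) =>
    emp (fun e => ((N z)^-1 + 2 - emp (fun f => le_lt (g e) (g f))) *
                  ((N z)^-1 + 2 - emp (fun f => le_lt (h e) (h f))))
    - (1 + (N z)^-1) ^+ 2) :
  0 < N z ->
  avg_spearman R (m z) a b =
  A (source_deg a (m := m z)) (target_deg b (m := m z)) /
  (Num.sqrt (A (source_deg a (m := m z)) (source_deg a (m := m z))) *
   Num.sqrt (A (target_deg b (m := m z)) (target_deg b (m := m z)))).
Proof.
move=> N0; rewrite /avg_spearman nb_edgesE.
have sq (h : edge (m z) -> nat) :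
    \sum_e avg_rank R h e ^+ 2 = \sum_e avg_rank R h e * avg_rank R h e by [].
rewrite !sq !sum_avg_rank_emp// -/(A _ _).
have N3 : 0 < N z ^+ 3 by rewrite exprn_gt0.
rewrite !(sqrtrM _ (ltW N3)) mulrACA -expr2 sqr_sqrtr ?ltW//.
by rewrite -mulf_div divff ?mul1r// gt_eqF.
Qed.

Lemma kendall_emp z a b : 0 < N z -> kendall R (m z) a b =
  (emp (fun e : edge (m z) => emp (fun f : edge (m z) =>
     le_lt (source_deg a e) (source_deg a f) *
     le_lt (target_deg b e) (target_deg b f))) - 1) / (1 - (N z)^-1).
Proof.
move=> N0; rewrite kendallE {1}/emp.
under [in RHS]eq_bigr do rewrite /emp.
rewrite -mulr_suml; set S := \sum_e _.
(* With a single edge both denominators vanish, so both sides are 0. *)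
have [N1|N1] := eqVneq (N z - 1) 0.
  rewrite N1 (_ : N z = 1) ?invr1 ?subrr ?mulr0 ?invr0 ?mulr0//.
  by move/eqP: N1; rewrite subr_eq0 => /eqP.
by field; rewrite N1 gt_eqF.
Qed.

End Degrees.

Section Limits.
Variables a b : direction.
Local Notation x z := (source_deg a (m := m z)).
Local Notation y z := (target_deg b (m := m z)).
Hypothesis p_cvg : forall k l, (fun z =>
  emp (fun e : edge (m z) => ((x z e == k) && (y z e == l))%:R : R)) @ F --> p k l.

Let emp_cvg' := @emp_cvg _ _ F _ _ (fun z => x z) (fun z => y z) p p_mass p_cvg.

Lemma norm_le_lt k l : `|le_lt k l : R| <= 2.
Proof. by rewrite ger0_norm ?le_lt_ge0 ?le_lt_le2. Qed.

(** Two nested uses of [emp_cvg]: the mean over [f] converges to [H] at fixed degrees, and is then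
    itself the varying function averaged over [e]. *)
Lemma kendall_cvg (H : nat -> nat -> R) (v : R) :
  (forall k l, box (fun k' l' => p k' l' * (le_lt k k' * le_lt l l')) @ \oo
     --> H k l) ->
  box (fun k l => p k l * H k l) @ \oo --> v ->
  (fun z => kendall R (m z) a b) @ F --> v - 1.
Proof.
move=> H_cvg v_cvg.
have bound k l k' l' : `|le_lt k k' * le_lt l l' : R| <= 4.
  by rewrite normrM (_ : 4 = 2 * 2) ?ler_pM ?norm_le_lt//; ring.
suff : (fun z => (emp (fun e : edge (m z) => emp (fun f : edge (m z) =>
     le_lt (x z e) (x z f) * le_lt (y z e) (y z f))) - 1) / (1 - (N z)^-1))
     @ F --> (v - 1) / (1 - 0).
  rewrite subr0 divr1; apply: cvg_trans; apply: near_eq_cvg.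
  by near=> z; rewrite kendall_emp//; near: z.
apply: cvgM; last first.
  apply: cvgV; first by rewrite subr0.
  by apply: cvgB => //; exact: cvg_cst.
apply: cvgB; last exact: cvg_cst.
apply: (@emp_cvg' v 4 (fun z k l => emp (fun f : edge (m z) =>
   le_lt k (x z f) * le_lt l (y z f))) H) => //.
- by move=> z k l; apply: norm_emp_bound => // f; exact: bound.
- move=> k l.
  apply: (@emp_cvg' _ 4 (fun _ k' l' => le_lt k k' * le_lt l l')
    (fun k' l' => le_lt k k' * le_lt l l')) => // *; exact: cvg_cst.
Unshelve. all: by end_near. Qed.

(** [1 < vX] and [1 < vY] keep the limiting denominator away from zero, where inversion is
    continuous. *)
Lemma avg_spearman_cvg (fX fY : nat -> R) (v vX vY : R) :
  (forall k, box (fun k' l' => p k' l' * le_lt k k') @ \oo --> fX k) ->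
  (forall l, box (fun k' l' => p k' l' * le_lt l l') @ \oo --> fY l) ->
  box (fun k l => p k l * fX k) @ \oo --> (1 : R) ->
  box (fun k l => p k l * fY l) @ \oo --> (1 : R) ->
  box (fun k l => p k l * (fX k * fY l)) @ \oo --> v ->
  box (fun k l => p k l * (fX k * fX k)) @ \oo --> vX ->
  box (fun k l => p k l * (fY l * fY l)) @ \oo --> vY ->
  1 < vX -> 1 < vY ->
  (fun z => avg_spearman R (m z) a b) @ F -->
    (v - 1) / (Num.sqrt (vX - 1) * Num.sqrt (vY - 1)).
Proof.
move=> fX_cvg fY_cvg fX1 fY1 v_cvg vX_cvg vY_cvg vX1 vY1.
pose sX z k (l : nat) : R := emp (fun f => le_lt k (x z f)).
pose sY z (k : nat) l : R := emp (fun f => le_lt l (y z f)).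
have emp02 z (h : edge (m z) -> nat) k :
    0 <= emp (fun f => le_lt k (h f) : R) <= 2.
  rewrite emp_ge0 => [/=|f]; last exact: le_lt_ge0.
  by rewrite (le_trans (ler_norm _))// norm_emp_bound// => f; exact: norm_le_lt.
have sX_cvg k l : sX ^~ k ^~ l @ F --> fX k.
  apply: (@emp_cvg' _ 2 (fun _ k' l' => le_lt k k') (fun k' _ => le_lt k k')) => //.
    by move=> *; exact: norm_le_lt.
  by move=> *; exact: cvg_cst.
have sY_cvg k l : sY ^~ k ^~ l @ F --> fY l.
  apply: (@emp_cvg' _ 2 (fun _ k' l' => le_lt l l') (fun _ l' => le_lt l l')) => //.
    by move=> *; exact: norm_le_lt.
  by move=> *; exact: cvg_cst.
pose A s t (z : Z) : R := emp (fun e : edge (m z) =>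
  ((N z)^-1 + 2 - s z (x z e) (y z e)) * ((N z)^-1 + 2 - t z (x z e) (y z e)))
  - (1 + (N z)^-1) ^+ 2.
have AXY : A sX sY @ F --> v - 1.
  by apply: rank_mean_cvg v_cvg => // z k l; exact: emp02.
have AXX : A sX sX @ F --> vX - 1.
  by apply: rank_mean_cvg vX_cvg => // z k l; exact: emp02.
have AYY : A sY sY @ F --> vY - 1.
  by apply: rank_mean_cvg vY_cvg => // z k l; exact: emp02.
suff : (fun z => A sX sY z / (Num.sqrt (A sX sX z) * Num.sqrt (A sY sY z))) @ F
    --> (v - 1) / (Num.sqrt (vX - 1) * Num.sqrt (vY - 1)).
  apply: cvg_trans; apply: near_eq_cvg.
  by near=> z; rewrite avg_spearman_emp//; near: z.
apply: cvgM => //; apply: cvgV.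
  by rewrite mulf_neq0// sqrtr_eq0 -ltNge subr_gt0.
by apply: cvgM; [move: AXX|move: AYY] => h;
  exact: (cvg_comp _ _ h (@sqrt_continuous R _)).
Unshelve. all: by end_near. Qed.

End Limits.
End CoefficientLimits.

(** * Random tie-breaking: averaging over bins *)

Section Bins.
Context {R : realType}.

(** The index [i] of the cell [[i / M, (i + 1) / M)] containing [r]; negative numbers are sent to
    0. *)
Definition bin (M : nat) (r : R) : nat := Num.truncn (M%:R * r).

Lemma bin_lt M r : (0 < M)%N -> 0 <= r < 1 -> (bin M r < M)%N.
Proof.
move=> M0 /andP[r0 r1]; rewrite /bin truncn_lt_nat ?mulr_ge0//.
by rewrite -[X in _ < X]mulr1 ltr_pM2l// ltr0n.
Qed.

Lemma bin_mono M r s : (bin M r < bin M s)%N -> r < s.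
Proof.
by apply: contraTT; rewrite -leNgt -leqNgt => sr; rewrite le_truncn// ler_wpM2l.
Qed.

Variables (V : finType) (m : multigraph V) (M : nat).
Variables (x : edge m -> nat) (u : edge m -> R).
Hypothesis u01 : forall e, 0 <= u e < 1.

(** A normalised rank in which ties are decided by the cells, edges of the same cell counting one
    half. *)
Definition bin_rank (k i : nat) : R :=
  emp (fun f => (k < x f)%N%:R + (x f == k)%:R * (le_lt (bin M (u f)) i / 2)).

Lemma norm_bin_rank_le1 k i : `|bin_rank k i| <= 1.
Proof.
apply: norm_emp_bound => // f.
have := @le_lt_ge0 R (bin M (u f)) i; have := @le_lt_le2 R (bin M (u f)) i.
by case: ltngtP => _ /= ? ?;
  rewrite ?mul1r ?mul0r ?add0r ?addr0 ?normr1 ?normr0 ?ger0_norm; lra.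
Qed.

Lemma rank_bin_rank e :
  `|rank x u e / #|edge m|%:R - bin_rank (x e) (bin M (u e))| <=
  2^-1 * emp (fun f => (bin M (u f) == bin M (u e))%:R).
Proof.
rewrite -[rank x u e / _]/(emp (fun f => ((x e)%:R + u e <= (x f)%:R + u f)%R%:R)).
rewrite -empB (le_trans (norm_emp_le _))// -empZ; apply: ler_emp => f.
have /andP[f0 f1] := u01 f; have /andP[e0 e1] := u01 e.
case: (ltngtP (x e) (x f)) => [xlt|xgt|->].
(* Distinct degrees differ by at least 1, which tie-breakers in [[0, 1)] cannot offset. *)
- have : (x e).+1%:R <= (x f)%:R :> R by rewrite ler_nat.
  rewrite -natr1 => h; have -> : (x e)%:R + u e <= (x f)%:R + u f by lra.
  by rewrite /= mul0r addr0 subrr normr0 mulr_ge0// invr_ge0.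
- have : (x f).+1%:R <= (x e)%:R :> R by rewrite ler_nat.
  rewrite -natr1 => h; have -> : ((x e)%:R + u e <= (x f)%:R + u f) = false by lra.
  by rewrite /= mul0r addr0 subrr normr0 mulr_ge0// invr_ge0.
rewrite lerD2l add0r mul1r /le_lt.
case: (ltngtP (bin M (u e)) (bin M (u f))) => [blt|bgt|_].
- by rewrite (ltW (bin_mono blt)) ler_norml /=; apply/andP; split; lra.
- by rewrite (lt_geF (bin_mono bgt)) ler_norml /=; apply/andP; split; lra.
- by case: (u e <= u f); rewrite ler_norml /=; apply/andP; split; lra.
Qed.

End Bins.

(** * Products of random ranks as the number of bins grows *)

Section TiesLimit.
Context {R : realType} {Z : Type} (F : set_system Z) {FF : Filter F}.
Variables (V : Z -> finType) (m : forall z, multigraph (V z)).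
Arguments m : clear implicits.
Local Notation N z := (#|edge (m z)|%:R : R).
Hypothesis N_gt0 : \forall z \near F, 0 < N z.
Variable p : nat -> nat -> R.
Hypothesis p_mass : box p @ \oo --> (1 : R).
Variables x y : forall z, edge (m z) -> nat.
Hypothesis p_cvg : forall k l, (fun z =>
  emp (fun e : edge (m z) => ((x e == k) && (y e == l))%:R : R)) @ F --> p k l.

(** Summing over the [M] cells of the other tie-breaker turns [M%:R^-1 ^+ 2] into [M%:R^-1]. *)
Lemma bin_cvg_marginal (u w : forall z, edge (m z) -> R) M (i : 'I_M) k l :
  (\forall z \near F, forall e : edge (m z), 0 <= w z e < 1) ->
  (forall j : 'I_M, (fun z => emp (fun e : edge (m z) =>
      ((bin M (u z e) == i) && (bin M (w z e) == j))%:R *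
      ((x e == k) && (y e == l))%:R : R)) @ F --> M%:R^-1 ^+ 2 * p k l) ->
  (fun z => emp (fun e : edge (m z) =>
    (bin M (u z e) == i)%:R * ((x e == k) && (y e == l))%:R : R)) @ F -->
  M%:R^-1 * p k l.
Proof.
move=> w01 bin_cvg; have M0 : (0 < M)%N by case: i bin_cvg => i; case: (M).
have -> : M%:R^-1 * p k l = \sum_(j < M) M%:R^-1 ^+ 2 * p k l.
  by rewrite sumr_cst card_ord; field; rewrite pnatr_eq0 -lt0n.
apply: near_cvg (@cvg_sum R Z _ F _ (index_enum _) xpredT _ _
  (fun j _ => bin_cvg j)); near=> z.
have h : forall e : edge (m z), 0 <= w z e < 1 by near: z.
rewrite -emp_sum; congr emp; apply/funext => e; rewrite -mulr_suml; congr (_ * _).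
transitivity (\sum_(j < M) (bin M (w z e) == j)%:R * (bin M (u z e) == i)%:R : R).
  by apply: eq_bigr => j _; rewrite -natrM mulnb andbC.
by rewrite (sum_indic (fun=> (bin M (u z e) == i)%:R)) bin_lt ?mul1r.
Unshelve. all: by end_near. Qed.

(** Taking for [pr] either projection serves both ends of an edge. In the limit [t] is the mass
    above [k], [g] the mass at [k], and inside the tie all cells weigh the same. *)
Lemma cvg_bin_rank (pr : nat -> nat -> nat) (w : forall z, edge (m z) -> R)
    M (i k : nat) (t g : R) :
  (0 < M)%N -> (\forall z \near F, forall e : edge (m z), 0 <= w z e < 1) ->
  (forall (j : 'I_M) k' l', (fun z => emp (fun e : edge (m z) =>
      (bin M (w z e) == j)%:R * ((x e == k') && (y e == l'))%:R : R)) @ F -->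
      M%:R^-1 * p k' l') ->
  box (fun k' l' => p k' l' * (k < pr k' l')%N%:R) @ \oo --> t ->
  box (fun k' l' => p k' l' * (pr k' l' == k)%:R) @ \oo --> g ->
  (fun z => bin_rank M (fun e : edge (m z) => pr (x e) (y e)) (w z) k i) @ F
    --> t + g * (\sum_(j < M) le_lt j i / 2) / M%:R.
Proof.
move=> M0 w01 w_cvg t_cvg g_cvg.
rewrite (_ : g * _ / _ = \sum_(j < M) le_lt j i / 2 * (M%:R^-1 * g)); last first.
  by rewrite -!mulr_suml; ring.
have norm_bool (b : bool) : `|b%:R : R| <= 1 by case: b; rewrite ?normr1 ?normr0.
have cvg_const (c : R) : (fun=> c) @ F --> c by exact: cvg_cst.
have t' := emp_cvg p_mass p_cvg (phi_ := fun _ k' l' => (k < pr k' l')%N%:R)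
  (fun _ _ _ => norm_bool _) (fun _ _ => cvg_const _) t_cvg.
have g' (j : 'I_M) : (fun z => emp (fun e : edge (m z) =>
    (bin M (w z e) == j)%:R * (pr (x e) (y e) == k)%:R)) @ F --> M%:R^-1 * g.
  apply: (weighted_emp_cvg p_mass p_cvg _ (w_cvg j)
    (phi_ := fun _ k' l' => (pr k' l' == k)%:R) (C := 1) _ _ g_cvg) => //.
  by move=> z e; rewrite ler0n lern1 leq_b1.
have s' : (fun z => \sum_(j < M) le_lt j i / 2 * emp (fun e : edge (m z) =>
    (bin M (w z e) == j)%:R * (pr (x e) (y e) == k)%:R)) @ F -->
    \sum_(j < M) le_lt j i / 2 * (M%:R^-1 * g).
  by apply: cvg_sum => j _; apply: cvgM.
apply: near_cvg (cvgD (t' FF) s'); near=> z.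
have h : forall e : edge (m z), 0 <= w z e < 1 by near: z.
rewrite /bin_rank empD /=; congr (_ + _).
under eq_bigr do rewrite -empZ.
rewrite -emp_sum; congr emp; apply/funext => e.
transitivity (\sum_(j < M) (bin M (w z e) == j)%:R *
    (le_lt j i / 2 * (pr (x e) (y e) == k)%:R : R)).
  by apply: eq_bigr => j _; ring.
rewrite (sum_indic (fun j => le_lt j i / 2 * (pr (x e) (y e) == k)%:R)).
by rewrite bin_lt// mul1r mulrC.
Unshelve. all: by end_near. Qed.

Variables u w : forall z, edge (m z) -> R.
Hypothesis u01 : \forall z \near F, forall e : edge (m z), 0 <= u e < 1.
Hypothesis w01 : \forall z \near F, forall e : edge (m z), 0 <= w e < 1.
Hypothesis bin_cvg : forall M (i j : 'I_M) k l, (fun z =>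
  emp (fun e : edge (m z) => ((bin M (u e) == i) && (bin M (w e) == j))%:R *
    ((x e == k) && (y e == l))%:R : R)) @ F --> M%:R^-1 ^+ 2 * p k l.

Let bin_cvg_u M (i : 'I_M) k l : (fun z => emp (fun e : edge (m z) =>
    (bin M (u e) == i)%:R * ((x e == k) && (y e == l))%:R : R)) @ F -->
  M%:R^-1 * p k l.
Proof. by apply: bin_cvg_marginal w01 _ => j; exact: bin_cvg. Qed.

Let bin_cvg_w M (j : 'I_M) k l : (fun z => emp (fun e : edge (m z) =>
    (bin M (w e) == j)%:R * ((x e == k) && (y e == l))%:R : R)) @ F -->
  M%:R^-1 * p k l.
Proof.
apply: bin_cvg_marginal u01 _ => i.
under eq_fun do under eq_fun do rewrite andbC.
exact: bin_cvg.
Qed.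

(* Averaging the rank over a bin misjudges only the comparisons with edges of the
   same bin, by one half each. For M bins the bound tends to 1 / M. *)
Lemma ties_bin_bound M z : (0 < M)%N -> 0 < N z ->
  (forall e : edge (m z), 0 <= u e < 1) ->
  (forall e : edge (m z), 0 <= w e < 1) ->
  `|emp (fun e : edge (m z) =>
       rank (x (z := z)) (u (z := z)) e / N z *
       (rank (y (z := z)) (w (z := z)) e / N z))
    - \sum_(i < M) \sum_(j < M) emp (fun e : edge (m z) =>
       ((bin M (u e) == i) && (bin M (w e) == j))%:R *
       (bin_rank M (x (z := z)) (u (z := z)) (x e) i *
        bin_rank M (y (z := z)) (w (z := z)) (y e) j))| <=
  2^-1 * (\sum_(i < M) emp (fun e : edge (m z) => (bin M (u e) == i)%:R) ^+ 2) +
  2^-1 * (\sum_(j < M) emp (fun e : edge (m z) => (bin M (w e) == j)%:R) ^+ 2).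
Proof.
move=> M0 N0 uz wz.
(* The squared cell frequencies add up to the proportion of ordered pairs of edges sharing a
   cell. *)
have sq (v : edge (m z) -> R) : (forall e, 0 <= v e < 1) ->
    \sum_(i < M) emp (fun e => (bin M (v e) == i)%:R : R) ^+ 2 =
    emp (fun e => emp (fun f => (bin M (v f) == bin M (v e))%:R : R)).
  move=> v01; transitivity (emp (fun e => \sum_(i < M) (bin M (v e) == i)%:R *
      emp (fun f => (bin M (v f) == i)%:R : R))).
    rewrite emp_sum; apply: eq_bigr => i _; rewrite expr2 -empZ.
    by congr emp; apply/funext => e; rewrite mulrC.
  congr emp; apply/funext => e.
  by rewrite (sum_indic (fun i => emp (fun f => (bin M (v f) == i)%:R)))
    bin_lt// mul1r.
rewrite !sq// -!empZ -empD.
under [X in _ - X]eq_bigr do rewrite -emp_sum.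
rewrite -emp_sum -empB (le_trans (norm_emp_le _))//; apply: ler_emp => e.
set r := bin_rank M _ _; set s := bin_rank M _ _.
have -> : \sum_(i < M) \sum_(j < M)
    ((bin M (u e) == i) && (bin M (w e) == j))%:R * (r (x e) i * s (y e) j) =
    r (x e) (bin M (u e)) * s (y e) (bin M (w e)).
  have := box_indic (fun i j => r (x e) i * s (y e) j) M (bin M (u e)) (bin M (w e)).
  by rewrite /box !bin_lt// mul1r.
have hr := rank_bin_rank M (x (z := z)) uz e.
have hs := rank_bin_rank M (y (z := z)) wz e.
have r1 : `|r (x e) (bin M (u e))| <= 1 by exact: norm_bin_rank_le1.
have q1 : `|rank (y (z := z)) (w (z := z)) e / N z| <= 1.
  rewrite ger0_norm ?divr_ge0 ?rank_ge0//.
  by rewrite ler_pdivrMr// mul1r rank_le.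
rewrite -/r in hr; rewrite -/s in hs.
move: hr hs r1 q1; set A := rank _ _ _ / _; set B := rank _ _ _ / _.
set C := r _ _; set D := s _ _; move: A B C D => A B C D hr hs r1 q1.
(* Changing one factor at a time leaves a cofactor of modulus at most 1. *)
rewrite (_ : _ - _ = (A - C) * B + C * (B - D)); last by ring.
rewrite (le_trans (ler_normD _ _))// !normrM lerD//.
  by rewrite -[X in _ <= X]mulr1; apply: ler_pM.
by rewrite -[X in _ <= X]mul1r; apply: ler_pM.
Qed.

(** The limit is the mean of [(tX + gX / 2) * (tY + gY / 2)] multiplied out: a rank counts on
    average half of its tie. *)
Lemma cvg_emp_rank (tX gX tY gY : nat -> R) (v1 v2 v3 v4 : R) :
  (forall k, box (fun k' l' => p k' l' * (k < k')%N%:R) @ \oo --> tX k) ->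
  (forall k, box (fun k' l' => p k' l' * (k' == k)%:R) @ \oo --> gX k) ->
  (forall l, box (fun k' l' => p k' l' * (l < l')%N%:R) @ \oo --> tY l) ->
  (forall l, box (fun k' l' => p k' l' * (l' == l)%:R) @ \oo --> gY l) ->
  box (fun k l => p k l * (tX k * tY l)) @ \oo --> v1 ->
  box (fun k l => p k l * (tX k * gY l)) @ \oo --> v2 ->
  box (fun k l => p k l * (gX k * tY l)) @ \oo --> v3 ->
  box (fun k l => p k l * (gX k * gY l)) @ \oo --> v4 ->
  (fun z => emp (fun e : edge (m z) =>
       rank (x (z := z)) (u (z := z)) e / N z *
       (rank (y (z := z)) (w (z := z)) e / N z))) @ F -->
  v1 + v2 / 2 + v3 / 2 + v4 / 4.
Proof.
move=> tX_cvg gX_cvg tY_cvg gY_cvg v1_cvg v2_cvg v3_cvg v4_cvg.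
set v := v1 + _ + _ + _.
have cvg_const (c : R) : (fun=> c) @ F --> c by exact: cvg_cst.
(* The limiting share of its tie that a rank in cell [i] counts. Its mean over [i] is exactly 1/2,
   so the limit of [T M] does not depend on [M]. *)
pose c M i : R := (\sum_(j < M) le_lt j i / 2) / M%:R.
have sum_c M : (0 < M)%N -> \sum_(i < M) c M i = M%:R / 2.
  move=> M0; rewrite -mulr_suml.
  under eq_bigr do rewrite -mulr_suml.
  rewrite -mulr_suml exchange_big/= (sum_le_lt (fun i : 'I_M => i : nat)) card_ord.
  by field; rewrite pnatr_eq0 -lt0n.
pose T M z := \sum_(i < M) \sum_(j < M) emp (fun e : edge (m z) =>
       ((bin M (u e) == i) && (bin M (w e) == j))%:R *
       (bin_rank M (x (z := z)) (u (z := z)) (x e) i *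
        bin_rank M (y (z := z)) (w (z := z)) (y e) j)).
have T_cvg M : (0 < M)%N -> T M @ F --> v.
  move=> M0; have -> : v = \sum_(i < M) \sum_(j < M) M%:R^-1 ^+ 2 *
      (v1 + (c M j * v2 + (c M i * v3 + c M i * c M j * v4))).
    have affine (A B : R) : \sum_(j < M) (A + B * c M j) = A * M%:R + B * (M%:R / 2).
      by rewrite big_split/= sumr_cst card_ord -mulr_sumr sum_c.
    pose q : R := M%:R^-1 ^+ 2.
    transitivity (\sum_(i < M) (q * (v1 * M%:R + v2 * (M%:R / 2)) +
        q * (v3 * M%:R + v4 * (M%:R / 2)) * c M i)).
      by rewrite affine /v /q; field; rewrite pnatr_eq0 -lt0n.
    apply: eq_bigr => i _; transitivity (\sum_(j < M) (q * (v1 + c M i * v3) +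
        q * (v2 + c M i * v4) * c M j)); first by rewrite affine; ring.
    by apply: eq_bigr => j _; rewrite /q; ring.
  apply: cvg_sum => i _; apply: cvg_sum => j _.
  apply: (weighted_emp_cvg p_mass p_cvg _ (bin_cvg i j) (C := 1)
    (phi_ := fun z k l => bin_rank M (x (z := z)) (u (z := z)) k i *
        bin_rank M (y (z := z)) (w (z := z)) l j)
    (phi := fun k l => (tX k + gX k * c M i) * (tY l + gY l * c M j))).
  - by move=> z e; rewrite ler0n lern1 leq_b1.
  - move=> z k l; rewrite normrM -[X in _ <= X]mulr1.
    by apply: ler_pM => //; exact: norm_bin_rank_le1.
  - move=> k l; apply: cvgM.
      rewrite /c mulrA.
      exact: (@cvg_bin_rank (fun k _ => k) u M i k (tX k) (gX k)).
    rewrite /c mulrA.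
    exact: (@cvg_bin_rank (fun _ l => l) w M j l (tY l) (gY l)).
  - rewrite (@eq_box _ _ (fun k l => p k l * (tX k * tY l) +
      (c M j * (p k l * (tX k * gY l)) + (c M i * (p k l * (gX k * tY l)) +
       c M i * c M j * (p k l * (gX k * gY l)))))); last by move=> k l; ring.
    by do !(apply: box_cvgD || apply: box_cvgZ).
pose err M (h : forall z, edge (m z) -> R) z : R :=
  2^-1 * (\sum_(i < M) emp (fun e => (bin M (h z e) == i)%:R) ^+ 2).
have err_cvg M (h : forall z, edge (m z) -> R) : (0 < M)%N ->
    (forall (i : 'I_M) k l, (fun z => emp (fun e : edge (m z) =>
    (bin M (h z e) == i)%:R * ((x e == k) && (y e == l))%:R : R)) @ F -->
      M%:R^-1 * p k l) -> err M h @ F --> ((2 * M%:R)^-1 : R).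
  move=> M0 h_cvg; have -> : (2 * M%:R)^-1 = 2^-1 * (\sum_(i < M) M%:R^-1 ^+ 2) :> R.
    by rewrite sumr_cst card_ord; field; rewrite pnatr_eq0 -lt0n.
  apply: cvgM => //; apply: cvg_sum => i _.
  have h1 : (fun z => emp (fun e : edge (m z) => (bin M (h z e) == i)%:R : R)) @ F
      --> (M%:R^-1 : R).
    rewrite -[X in _ --> X]mulr1.
    under eq_fun do under eq_fun do rewrite -[_%:R]mulr1.
    apply: (weighted_emp_cvg p_mass p_cvg _ (h_cvg i) (C := 1)
      (phi_ := fun _ _ _ => 1) (phi := fun _ _ => 1)) => //.
    - by move=> z e; rewrite ler0n lern1 leq_b1.
    - by move=> *; rewrite normr1.
    - by rewrite (@eq_box _ _ p)// => *; rewrite mulr1.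
  by under eq_fun do rewrite expr2; rewrite expr2; apply: cvgM.
apply/cvgrPdist_le => eps eps0.
(* Then [(2 * M)^-1 <= eps / 8], so each [err] is eventually at most [eps / 8 + eps / 4]; the two
   together leave [eps / 4] for [T M]. *)
pose M := (Num.truncn (4 / eps)).+1.
have M0 : (0 < M)%N by [].
have Meps : (2 * M%:R)^-1 <= eps / 8 :> R.
  have : 4 / eps < M%:R by rewrite truncnS_gt.
  rewrite ltr_pdivrMr// => h.
  have M0' : 0 < 2 * M%:R :> R by rewrite mulr_gt0// ltr0n.
  by rewrite -[X in X <= _]div1r ler_pdivrMr//; lra.
have eps4 : 0 < eps / 4 by rewrite divr_gt0.
have /cvgrPdist_le/(_ _ eps4) := T_cvg M M0.
have /cvgrPdist_le/(_ _ eps4) := err_cvg M u M0 (bin_cvg_u (M := M)).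
have /cvgrPdist_le/(_ _ eps4) := err_cvg M w M0 (bin_cvg_w (M := M)).
move=> near1 near2 near3; near=> z.
have h1 : `|(2 * M%:R)^-1 - err M w z| <= eps / 4 by near: z; exact: near1.
have h2 : `|(2 * M%:R)^-1 - err M u z| <= eps / 4 by near: z; exact: near2.
have h3 : `|v - T M z| <= eps / 4 by near: z; exact: near3.
have h4 : 0 < N z by near: z.
have h5 : forall e : edge (m z), 0 <= u e < 1 by near: z.
have h6 : forall e : edge (m z), 0 <= w e < 1 by near: z.
have := ties_bin_bound M0 h4 h5 h6.
rewrite -/(T M z) -/(err M u z) -/(err M w z) => h7.
move: h1 h2 h3 h7 Meps; rewrite !ler_norml.
move: (emp _) (T M z) (err M u z) (err M w z) ((2 * M%:R)^-1) => S t e1 e2 q.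
move=> /andP[? ?] /andP[? ?] /andP[? ?] /andP[? ?] ?.
apply/andP; split; lra.
Unshelve. all: by end_near. Qed.

End TiesLimit.

Lemma spearman_emp {R : realType} (V : finType) (m : multigraph V) a b
    (u w : edge m -> R) (N := #|edge m|%:R : R) : 0 < N ->
  spearman a b u w =
  (12 * emp (fun e => rank (source_deg a (m := m)) u e / N *
                      (rank (target_deg b (m := m)) w e / N))
   - 3 * (1 + N^-1) ^+ 2) / (1 - N^-1 ^+ 2).
Proof.
move=> N0; rewrite /spearman nb_edgesE -/N /emp.
under [in RHS]eq_bigr do rewrite mulrACA.
rewrite -mulr_suml; set S := \sum_e _; rewrite -/N.
move: S (N) N0 => S n n0; have nn0 : n != 0 by rewrite gt_eqF.
have n3 : n ^+ 3 - n = n * (n ^+ 2 - 1) by ring.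
have n2 : 1 - n^-1 ^+ 2 = (n ^+ 2 - 1) / n ^+ 2 by field.
(* The case of one edge, where both denominators are zero. *)
have [n1|n1] := eqVneq (n ^+ 2 - 1) 0.
  by rewrite n3 n2 n1 mul0r !mulr0 !invr0 !mulr0.
by rewrite n3 n2; field; rewrite nn0.
Qed.

Lemma spearman_cvg {R : realType} {Z : Type} (F : set_system Z) {FF : Filter F}
    (V : Z -> finType) (m : forall z, multigraph (V z)) a b
    (u w : forall z, edge (m z) -> R) (v : R) :
  (fun z => (#|edge (m z)|%:R)^-1) @ F --> (0 : R) ->
  (\forall z \near F, 0 < #|edge (m z)|%:R :> R) ->
  (fun z => emp (fun e : edge (m z) =>
       rank (source_deg a (m := m z)) (u z) e / #|edge (m z)|%:R *
       (rank (target_deg b (m := m z)) (w z) e / #|edge (m z)|%:R))) @ F --> v ->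
  (fun z => spearman a b (u z) (w z)) @ F --> 12 * v - 3.
Proof.
move=> N_cvg N_gt0 v_cvg.
have cvg_const (c : R) : (fun=> c) @ F --> c by exact: cvg_cst.
rewrite (_ : 12 * v - 3 = (12 * v - 3 * ((1 + 0) * (1 + 0))) / (1 - 0 * 0)); last first.
  by field.
suff : (fun z => (12 * emp (fun e : edge (m z) =>
       rank (source_deg a (m := m z)) (u z) e / #|edge (m z)|%:R *
       (rank (target_deg b (m := m z)) (w z) e / #|edge (m z)|%:R))
   - 3 * ((1 + (#|edge (m z)|%:R)^-1) * (1 + (#|edge (m z)|%:R)^-1))) /
    (1 - (#|edge (m z)|%:R)^-1 * (#|edge (m z)|%:R)^-1)) @ F -->
    (12 * v - 3 * ((1 + 0) * (1 + 0))) / (1 - 0 * 0).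
  by apply: near_cvg; near=> z; rewrite spearman_emp//; near: z.
apply: cvgM; last apply: cvgV; first last.
- by apply: cvgB => //; apply: cvgM.
- by rewrite mulr0 subr0.
- apply: cvgB; apply: cvgM => //.
  by apply: cvgM; apply: cvgD.
Unshelve. all: by end_near. Qed.

(** * The law of the limiting degrees *)

Section Expectation.
Context d (T : measurableType d) (R : realType) (P : probability T R).

Lemma bounded_integrable (f : T -> R) (C : R) :
  measurable_fun setT f -> (forall t, `|f t| <= C) ->
  P.-integrable setT (EFin \o f).
Proof.
move=> mf fC; apply: measurable_bounded_integrable => //.
  by rewrite ltey_eq fin_num_measure.
exists C; split; first by rewrite num_real.
by move=> y Cy t _; apply: le_trans (ltW Cy); exact: fC.
Qed.

Lemma fine_expectation (f : T -> R) : fine 'E_P[f] = \int[P]_t f t.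
Proof. by rewrite unlock. Qed.

Lemma Rintegral_sum (D : set T) (I : Type) (s : seq I) (f : I -> T -> R) :
  measurable D -> (forall i, P.-integrable D (EFin \o f i)) ->
  \int[P]_(t in D) (\sum_(i <- s) f i t) = \sum_(i <- s) \int[P]_(t in D) f i t.
Proof.
move=> mD intf; rewrite /Rintegral.
under eq_integral do rewrite -sumEFin.
rewrite integral_sum// sum_fine// => i _.
by apply: integrable_fin_num => //; exact: intf.
Qed.

Lemma Rintegral_const (c : R) : \int[P]_t c = c.
Proof.
rewrite Rintegral_cst// -[RHS]mulr1; congr (_ * _); rewrite -[RHS]/(fine 1%E).
by congr fine; exact: probability_setT.
Qed.

Lemma Rintegral_indic (A : set T) : measurable A ->
  \int[P]_t \1_A t = fine (P A).
Proof. by move=> mA; rewrite /Rintegral integral_indic// setIT. Qed.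

End Expectation.

(** * Point masses and distribution functions of integer valued variables *)

Section LimitLaw.
Context d (T : measurableType d) (R : realType) (P : probability T R).

Definition law (X Y : {RV P >-> R}) (k l : nat) : R :=
  fine (P (X @^-1` [set k%:R] `&` Y @^-1` [set l%:R])).

Lemma int_valuedP (X : {RV P >-> R}) t : integer_valued X ->
  (exists n : nat, X t = n%:R) \/ X t < 0.
Proof.
move=> /(_ t) Xint; have [X0|] := ltP (X t) 0; first by right.
by left; move: Xint; rewrite intrEge0// => /natrP.
Qed.

Lemma measurable_preimage (X : {RV P >-> R}) (B : set R) :
  measurable B -> measurable (X @^-1` B).
Proof. by move=> mB; rewrite -[_ @^-1` _]setTI; exact: measurable_funP. Qed.

Lemma measurable_preimage_set1 (X : {RV P >-> R}) (r : R) :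
  measurable (X @^-1` [set r]).
Proof. exact: measurable_preimage. Qed.

Lemma measurable_lt0 (X : {RV P >-> R}) : measurable [set t | X t < 0].
Proof.
rewrite (_ : [set t | _] = X @^-1` `]-oo, 0[); first exact: measurable_preimage.
by apply/seteqP; split => t /=; rewrite in_itv.
Qed.

(** The pair takes countably many values, so every preimage is a countable union of level sets,
    whatever [g] is. *)
Lemma measurable_int_pair (X Y : {RV P >-> R}) (g : R -> R -> R) :
  integer_valued X -> integer_valued Y ->
  measurable_fun setT (fun t => g (X t) (Y t)).
Proof.
move=> Xint Yint _ B _; rewrite setTI.
rewrite (_ : _ @^-1` _ = \bigcup_(ij in [set: int * int])
   if g ij.1%:~R ij.2%:~R \in B
   then X @^-1` [set ij.1%:~R] `&` Y @^-1` [set ij.2%:~R] else set0).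
  apply: countable_bigcupT_measurable => [|ij]; first exact: countableP.
  by case: ifP => // _; apply: measurableI; exact: measurable_preimage_set1.
apply/seteqP; split => [t /= Bt|t /= [[i j] _] /=].
  have /intrP[i Xi] := Xint t; have /intrP[j Yj] := Yint t.
  by exists (i, j) => //=; rewrite -Xi -Yj mem_set.
by case: ifP => // /set_mem Bt [/= -> ->].
Qed.

Section Box.
Variables X Y : {RV P >-> R}.
Hypothesis X_int : integer_valued X.
Hypothesis Y_int : integer_valued Y.
Hypothesis X_ge0 : P [set t | X t < 0] = 0%E.
Hypothesis Y_ge0 : P [set t | Y t < 0] = 0%E.

(** Dominated convergence: a box sum is the expectation of [g (X t) (Y t)] cut off outside the box,
    and almost every outcome enters the box for large [K]. *)
Lemma box_cvg_expectation (g : R -> R -> R) (C : R) :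
  (forall a b, `|g a b| <= C) ->
  box (fun k l => law X Y k l * g k%:R l%:R) @ \oo -->
    fine 'E_P[fun t => g (X t) (Y t)].
Proof.
move=> gC; rewrite fine_expectation.
pose A k l := X @^-1` [set k%:R] `&` Y @^-1` [set l%:R].
have mA k l : measurable (A k l).
  by apply: measurableI; exact: measurable_preimage_set1.
pose f K t := box (fun k l => \1_(A k l) t * g k%:R l%:R) K.
have fE K t i j : X t = i%:R -> Y t = j%:R ->
    f K t = ((i < K) && (j < K))%N%:R * g (X t) (Y t).
  move=> Xi Yj; rewrite Xi Yj -(box_indic (fun k l => g k%:R l%:R)).
  apply: eq_bigr => k _; apply: eq_bigr => l _; congr (_ * _).
  rewrite indicE; congr (nat_of_bool _)%:R; apply/idP/idP.
    by rewrite inE /A /= Xi Yj => -[/eqP + /eqP]; rewrite !eqr_nat => -> ->.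
  by move=> /andP[/eqP ik /eqP jl]; rewrite inE /A /= Xi Yj ik jl.
have f0 K t : (X t < 0) \/ (Y t < 0) -> f K t = 0.
  move=> neg; apply: big1 => k _; apply: big1 => l _.
  rewrite indicE memNset ?mul0r// /A /= => -[Xk Yl].
  by move: neg; rewrite Xk Yl !ltrn0 => -[].
have C0 : 0 <= C by rewrite (le_trans _ (gC 0 0)).
have fC K t : `|f K t| <= C.
  have [[i Xi]|Xneg] := int_valuedP t X_int; last by rewrite f0 ?normr0//; left.
  have [[j Yj]|Yneg] := int_valuedP t Y_int; last by rewrite f0 ?normr0//; right.
  by rewrite (fE _ _ _ _ Xi Yj); case: (_ && _); rewrite ?mul1r ?mul0r ?normr0.
have int_term k l : P.-integrable setT (EFin \o (fun t => \1_(A k l) t * g k%:R l%:R)).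
  apply: (@bounded_integrable _ _ _ _ _ C).
    by apply: measurable_funM => //; exact: measurable_indic.
  move=> t; rewrite indicE; case: (_ \in _); rewrite ?mul1r ?mul0r ?normr0//.
have mf K : measurable_fun setT (f K).
  by do 2 (apply: measurable_sum => ?); apply: measurable_funM.
have boxE K : box (fun k l => law X Y k l * g k%:R l%:R) K = \int[P]_t f K t.
  rewrite /f /box Rintegral_sum//; last first.
    move=> k; apply: (@bounded_integrable _ _ _ _ _ (\sum_(l < K) C)).
      by apply: measurable_sum => l; apply: measurable_funM.
    move=> t; rewrite (le_trans (ler_norm_sum _ _ _))//; apply: ler_sum => l _.
    by rewrite indicE; case: (_ \in _); rewrite ?mul1r ?mul0r ?normr0.
  apply: eq_bigr => k _; rewrite Rintegral_sum//; apply: eq_bigr => l _.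
  under eq_Rintegral do rewrite mulrC.
  rewrite RintegralZl// ?Rintegral_indic// 1?mulrC//.
  exact: integrable_indic.
rewrite (funext boxE).
have mg := measurable_int_pair g X_int Y_int.
have ig : P.-integrable setT (EFin \o fun t => g (X t) (Y t)).
  by apply: (@bounded_integrable _ _ _ _ _ C).
suff : (fun K => \int[P]_t (f K t)%:E)%E @ \oo --> (\int[P]_t (g (X t) (Y t)))%:E.
  exact: fine_cvg.
rewrite /Rintegral fineK ?integrable_fin_num//.
have [] // := @dominated_convergence _ T R P setT measurableT
  (fun K => EFin \o f K) (EFin \o fun t => g (X t) (Y t)) (EFin \o cst C).
- by move=> K; exact/measurable_EFinP.
- exact/measurable_EFinP.
- exists ([set t | X t < 0] `|` [set t | Y t < 0]); split.
  + by apply: measurableU; exact: measurable_lt0.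
  + by apply: null_set_setU => //; exact: measurable_lt0.
  + move=> t /=; apply: contra_notP => /not_orP[X0 Y0] _.
    have [[i Xi]|//] := int_valuedP t X_int.
    have [[j Yj]|//] := int_valuedP t Y_int.
    apply: cvg_near_cst; near=> K.
    rewrite /= (fE K t i j)// (_ : _ && _ = true) ?mul1r//.
    by apply/andP; split; near: K; exact: nbhs_infty_gt.
- by apply: (@bounded_integrable _ _ _ _ _ C) => // t; rewrite ger0_norm.
- by apply: aeW => t K _ /=; rewrite lee_fin.
Unshelve. all: by end_near. Qed.

End Box.

Lemma df_ge0 X r : 0 <= df (P := P) X r.
Proof. by rewrite /df fine_ge0// cdf_ge0. Qed.

Lemma df_le1 X r : df (P := P) X r <= 1.
Proof. by rewrite -lee_fin fineK ?cdf_le1// fin_num_measure. Qed.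

Lemma df_mono X r s : r <= s -> df (P := P) X r <= df X s.
Proof.
by move=> rs; apply: fine_le; rewrite ?fin_num_measure// cdf_nondecreasing.
Qed.

Lemma expectation_le_indic (X : {RV P >-> R}) r :
  \int[P]_t (X t <= r)%R%:R = df X r.
Proof.
rewrite /df /cdf /distribution /pushforward -Rintegral_indic; last first.
  exact: measurable_preimage.
apply: eq_Rintegral => t _; rewrite indicE; congr (nat_of_bool _)%:R.
by apply/idP/idP; rewrite inE /= in_itv.
Qed.

Lemma expectation_joint_indic (X Y : {RV P >-> R}) r s :
  \int[P]_t ((X t <= r)%R%:R * (Y t <= s)%R%:R) = joint_df X Y r s.
Proof.
rewrite /joint_df -Rintegral_indic; last first.
  by apply: measurableI; exact: measurable_preimage.
apply: eq_Rintegral => t _; rewrite indicE -natrM mulnb; congr (nat_of_bool _)%:R.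
by apply/idP/idP; rewrite inE /= !in_itv/= => /andP.
Qed.

Section Marginal.
Variable X : {RV P >-> R}.
Hypothesis X_int : integer_valued X.
Hypothesis X_ge0 : P [set t | X t < 0] = 0%E.

(** Integrality leaves no mass strictly between [k - 1] and [k]. *)
Lemma df_step (k : nat) :
  fine (P (X @^-1` [set k%:R])) = df X k%:R - df X (k%:R - 1).
Proof.
apply/eqP; rewrite eq_sym subr_eq; apply/eqP.
rewrite /df /cdf /distribution /pushforward.
rewrite -fineD ?fin_num_measure//; try exact: measurable_preimage.
rewrite -measureU//; try exact: measurable_preimage.
- congr (fine (P _)); apply/seteqP; split => t /=; rewrite !in_itv/=.
    move=> Xk; have [->|Xk'] := eqVneq (X t) k%:R; [by left|right].
    have /intrP[i Xi] := X_int t.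
    move: Xk Xk'; rewrite Xi -[k%:R]/((k%:Z)%:~R) -[1]/(1%:~R) -rmorphB/=.
    rewrite !ler_int eqr_int.
    by move=> *; lia.
  by move=> [->//|/le_trans]; apply; rewrite lerBlDr lerDl.
- apply/seteqP; split => t //= -[->]; rewrite in_itv/= => h.
  by move: h; rewrite leNgt ltrBlDr ltrDl ltr01.
Qed.

Lemma df_N1 : df X (0%:R - 1) = 0.
Proof.
rewrite sub0r /df /cdf /distribution /pushforward.
suff -> : P (X @^-1` `]-oo, (-1)]) = 0%E by [].
apply/eqP; rewrite eq_le measure_ge0 andbT -X_ge0.
apply: le_measure; rewrite ?inE; [exact: measurable_preimage|exact: measurable_lt0|].
by move=> t /=; rewrite in_itv/= => /le_lt_trans; apply.
Qed.

(* With the law of the pair (X, X), which lives on the diagonal, the box sums of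
   a function of X are its partial sums. *)
Lemma sum_df_cvg (g : R -> R) (C : R) : (forall a, `|g a| <= C) ->
  (fun K => \sum_(k < K) (df X k%:R - df X (k%:R - 1)) * g k%:R) @ \oo -->
  \int[P]_t g (X t).
Proof.
move=> gC; rewrite -fine_expectation.
rewrite (_ : (fun K => _) = box (fun k l => law X X k l * g k%:R)).
  exact: (box_cvg_expectation X_int X_int X_ge0 X_ge0 (g := fun a _ => g a)
    (fun a _ => gC a)).
apply/funext => K; rewrite /box; apply/esym; apply: eq_bigr => k _.
rewrite (bigD1 k)//= big1 ?addr0.
  by rewrite /law setIid df_step.
move=> l lk; rewrite /law (_ : _ `&` _ = set0) ?measure0 ?mul0r//.
apply/seteqP; split => t //= -[->] /eqP; rewrite eqr_nat => /eqP kl.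
by move: lk; rewrite -val_eqE /= kl eqxx.
Qed.

Let sum_df_power n (g : R -> R) K :
  (forall a, (df X a - df X (a - 1)) * g a = df X a ^+ n.+1 - df X (a - 1) ^+ n.+1) ->
  \sum_(k < K) (df X k%:R - df X (k%:R - 1)) * g k%:R = df X (K%:R - 1) ^+ n.+1.
Proof.
move=> gE; under eq_bigr do rewrite gE.
elim: K => [|K IH]; first by rewrite big_ord0 df_N1 expr0n.
by rewrite big_ord_recr/= IH -natr1 addrK; ring.
Qed.

(** By the second hypothesis on [g] the sums of [sum_df_cvg] telescope, starting from [F(-1) = 0],
    to a power of [F(K - 1)], which tends to 1. *)
Lemma expectation_df_power n (g : R -> R) (C : R) : (forall a, `|g a| <= C) ->
  (forall a, (df X a - df X (a - 1)) * g a = df X a ^+ n.+1 - df X (a - 1) ^+ n.+1) ->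
  \int[P]_t g (X t) = 1.
Proof.
move=> gC gE; have := sum_df_cvg gC.
rewrite (funext (fun K => sum_df_power K gE)) => lim_g.
(* The same telescoping with [n = 0] and [g = 1] shows that the distribution function tends to 1. *)
have lim_1 : (fun K => df X (K%:R - 1)) @ \oo --> (1 : R).
  rewrite -[X in _ --> X](Rintegral_const P 1).
  rewrite (_ : (fun K => _) =
    (fun K => \sum_(k < K) (df X k%:R - df X (k%:R - 1)) * 1)).
    by apply: (@sum_df_cvg (fun=> 1) 1) => a; rewrite normr1.
  apply/funext => K; rewrite (@sum_df_power 0 (fun=> 1)) ?expr1// => a.
  by rewrite mulr1 !expr1.
have lim_n : (fun K => df X (K%:R - 1) ^+ n.+1) @ \oo --> (1 : R).
  rewrite -[X in _ --> X](expr1n _ n.+1).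
  exact: (cvg_comp _ _ lim_1 (@exprn_continuous R n.+1 1)).
rewrite -(cvg_lim (@norm_hausdorff _ _) lim_g).
exact: (cvg_lim (@norm_hausdorff _ _) lim_n).
Qed.

Lemma norm_df2 a : `|df2 X a| <= 2.
Proof.
by rewrite ger0_norm ?addr_ge0 ?df_ge0// (_ : 2 = 1 + 1) ?lerD ?df_le1.
Qed.

Lemma expectation_df2 : \int[P]_t df2 X (X t) = 1.
Proof.
apply: (@expectation_df_power 1 (df2 X) 2 norm_df2) => a.
by rewrite /df2; ring.
Qed.

Lemma measurable_int (g : R -> R) : measurable_fun setT (fun t => g (X t)).
Proof. exact: (measurable_int_pair (fun a _ => g a) X_int X_int). Qed.

(** With [F' = F(X - 1)], the square of [F + F'] is [F^2 + F F' + F'^2] plus [F F']. The former is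
    the cofactor of [F - F'] in a difference of cubes, hence of mean 1. *)
Lemma expectation_df2_sqr : \int[P]_t (df2 X (X t) * df2 X (X t)) = 1 + S_moment X.
Proof.
rewrite /S_moment fine_expectation.
pose g a := df X a ^+ 2 + df X a * df X (a - 1) + df X (a - 1) ^+ 2.
have d1 a := df_le1 X a; have d0 a := df_ge0 X a.
have dd a b : 0 <= df X a * df X b <= 1.
  by rewrite mulr_ge0//= -[X in _ <= X]mulr1 ler_pM.
have gC a : `|g a| <= 3.
  rewrite /g !expr2 ger0_norm; first last.
    by rewrite !addr_ge0 ?mulr_ge0.
  by have := dd a a; have := dd a (a - 1); have := dd (a - 1) (a - 1); lra.
have g1 : \int[P]_t g (X t) = 1.
  by apply: (@expectation_df_power 2 g 3 gC) => a; rewrite /g; ring.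
rewrite -[X in X + _]g1 -RintegralD//.
- by apply: eq_Rintegral => t _; rewrite /df2 /g; ring.
- by apply: (@bounded_integrable _ _ _ _ _ 3) => //; exact: measurable_int.
- apply: (@bounded_integrable _ _ _ _ _ 1) => [|t].
    exact: (measurable_int (fun a => df X a * df X (a - 1))).
  by have /andP[h0 h1] := dd (X t) (X t - 1); rewrite ger0_norm.
Qed.

(** For two atoms [k1 < k2] one has [F(k2) >= q k2] and [F(k2 - 1) >= q k1], so the term of [k2]
    alone is positive. *)
Lemma S_moment_gt0 : ~ degenerate X -> 0 < S_moment X.
Proof.
move=> nondeg; pose q (k : nat) : R := fine (P (X @^-1` [set k%:R])).
have q0 k : 0 <= q k by rewrite fine_ge0.
have qE k : q k = df X k%:R - df X (k%:R - 1) by exact: df_step.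
have sum_q : (fun K => \sum_(k < K) q k) @ \oo --> (1 : R).
  have := @sum_df_cvg (fun=> 1) 1.
  rewrite Rintegral_const => h.
  by under eq_fun do under eq_bigr do rewrite qE -[_ - _]mulr1;
    apply: h => _; rewrite normr1.
have large c : c < 1 -> exists K, c < \sum_(k < K) q k.
  move=> c1; have c0 : 0 < 1 - c by rewrite subr_gt0.
  move/cvgrPdist_lt : sum_q => /(_ _ c0) /filter_ex[K].
  by rewrite ltr_norml => /andP[_ ?]; exists K; lra.
have [k1 qk1] : exists k, 0 < q k.
  have [K] := large 0 ltr01; apply: contraPP => /forallNP h.
  by apply/negP; rewrite -leNgt sumr_le0// => k _; rewrite leNgt; exact/negP.
have qk1_lt1 : q k1 < 1.
  rewrite lt_neqAle -lee_fin fineK ?fin_num_measure//; try exact: measurable_preimage_set1.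
  rewrite probability_le1 ?andbT; try exact: measurable_preimage_set1.
  apply/eqP => q1; apply: nondeg; exists k1%:R.
  rewrite -[LHS]fineK ?fin_num_measure//; try exact: measurable_preimage_set1.
  by rewrite -/(q k1) q1.
(* Were [k1] the only atom, the partial sums could never exceed [q k1 < 1]. *)
have [k2 k21 qk2] : exists2 k, k != k1 & 0 < q k.
  have [K] := large _ qk1_lt1; apply: contraPP => /forall2NP h.
  apply/negP; rewrite -leNgt.
  have -> : \sum_(k < K) q k = \sum_(k < K) (k1 == k)%:R * q k.
    apply: eq_bigr => k _; case: eqVneq => [<-|k1k]; first by rewrite mul1r.
    have [] := h k; first by rewrite eq_sym k1k.
    move=> /negP; rewrite -leNgt => qk; rewrite mul0r.
    by apply/eqP; rewrite eq_le qk q0.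
  by rewrite sum_indic; case: (_ < _)%N; rewrite ?mul1r ?mul0r.
wlog k12 : k1 k2 qk1 qk2 k21 {qk1_lt1} / (k1 < k2)%N.
  move=> wl; have [k12|k12|k12] := ltngtP k1 k2.
  - exact: wl qk1 qk2 k21 k12.
  - by apply: wl qk2 qk1 _ k12; rewrite eq_sym.
  - by move: k21; rewrite k12 eqxx.
have mono := @df_mono X.
have d0 := df_ge0 X.
pose g a := df X a * df X (a - 1).
have gC a : `|g a| <= 1.
  by rewrite ger0_norm ?mulr_ge0// -[X in _ <= X]mulr1 ler_pM ?df_le1.
have := sum_df_cvg gC; rewrite -fine_expectation => lim_S.
apply: (@lt_le_trans _ _ (q k2 * (q k2 * q k1))); first by rewrite !mulr_gt0.
apply: (cvgr_to_ge lim_S); near=> K.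
have k2K : (k2 < K)%N by near: K; exact: nbhs_infty_gt.
rewrite (bigD1 (Ordinal k2K))//= -qE.
apply: (@le_trans _ _ (q k2 * g k2%:R)); last first.
  rewrite lerDl sumr_ge0// => k _; rewrite -qE mulr_ge0// mulr_ge0//.
rewrite ler_wpM2l// ler_pM//.
  by rewrite qE lerBlDr lerDl.
apply: (@le_trans _ _ (df X k1%:R)); first by rewrite qE lerBlDr lerDl.
by apply: mono; rewrite lerBrDr natr1 ler_nat.
Unshelve. all: by end_near. Qed.

End Marginal.
End LimitLaw.

(** * Limits of the coefficients *)

Section DegreeLaw.
Context d (T : measurableType d) (R : realType) (P : probability T R).
Variables X Y : {RV P >-> R}.
Hypothesis X_int : integer_valued X.
Hypothesis Y_int : integer_valued Y.
Hypothesis X_ge0 : P [set t | X t < 0] = 0%E.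
Hypothesis Y_ge0 : P [set t | Y t < 0] = 0%E.

Lemma box_law_cvg (phi : nat -> nat -> R) (g : R -> R -> R) (C v : R) :
  (forall a b, `|g a b| <= C) -> (forall k l, phi k l = g k%:R l%:R) ->
  \int[P]_t g (X t) (Y t) = v ->
  box (fun k l => law X Y k l * phi k l) @ \oo --> v.
Proof.
move=> gC phiE <-; rewrite -fine_expectation (_ : phi = fun k l => g k%:R l%:R).
  exact: box_cvg_expectation gC.
by apply/funext => k; apply/funext => l.
Qed.

Lemma box_law_mass : box (law X Y) @ \oo --> (1 : R).
Proof.
rewrite (@eq_box _ _ (fun k l => law X Y k l * 1)); last by move=> *; rewrite mulr1.
apply: (box_law_cvg (g := fun _ _ => 1) (C := 1)) => //.
  by move=> *; rewrite normr1.
exact: Rintegral_const.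
Qed.

Let norm_bool (b : bool) : `|b%:R : R| <= 1.
Proof. by case: b; rewrite ?normr1 ?normr0. Qed.

Let le1_natr (k l : nat) : ((l%:R : R) <= k%:R - 1) = (l < k)%N.
Proof. by rewrite lerBrDr natr1 ler_nat. Qed.

Lemma box_law_lt_X k : box (fun k' l' => law X Y k' l' * (k' < k)%N%:R) @ \oo -->
  df X (k%:R - 1).
Proof.
apply: (box_law_cvg (g := fun a _ => (a <= k%:R - 1)%R%:R) (C := 1)) => [//|k' l'|].
  by rewrite le1_natr.
exact: expectation_le_indic.
Qed.

Lemma box_law_le_X k : box (fun k' l' => law X Y k' l' * (k' <= k)%N%:R) @ \oo -->
  df X k%:R.
Proof.
apply: (box_law_cvg (g := fun a _ => (a <= k%:R)%R%:R) (C := 1)) => [//|k' l'|].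
  by rewrite ler_nat.
exact: expectation_le_indic.
Qed.

Lemma box_law_lt_Y l : box (fun k' l' => law X Y k' l' * (l' < l)%N%:R) @ \oo -->
  df Y (l%:R - 1).
Proof.
apply: (box_law_cvg (g := fun _ b => (b <= l%:R - 1)%R%:R) (C := 1)) => [//|k' l'|].
  by rewrite le1_natr.
exact: expectation_le_indic.
Qed.

Lemma box_law_le_Y l : box (fun k' l' => law X Y k' l' * (l' <= l)%N%:R) @ \oo -->
  df Y l%:R.
Proof.
apply: (box_law_cvg (g := fun _ b => (b <= l%:R)%R%:R) (C := 1)) => [//|k' l'|].
  by rewrite ler_nat.
exact: expectation_le_indic.
Qed.

Lemma box_law_le_lt_X k : box (fun k' l' => law X Y k' l' * le_lt k k') @ \oo -->
  df2 X k%:R.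
Proof.
rewrite (@eq_box _ _ (fun k' l' => law X Y k' l' * (k' <= k)%N%:R +
  law X Y k' l' * (k' < k)%N%:R)); last by move=> *; rewrite mulrDr.
by apply: box_cvgD; [exact: box_law_le_X|exact: box_law_lt_X].
Qed.

Lemma box_law_le_lt_Y l : box (fun k' l' => law X Y k' l' * le_lt l l') @ \oo -->
  df2 Y l%:R.
Proof.
rewrite (@eq_box _ _ (fun k' l' => law X Y k' l' * (l' <= l)%N%:R +
  law X Y k' l' * (l' < l)%N%:R)); last by move=> *; rewrite mulrDr.
by apply: box_cvgD; [exact: box_law_le_Y|exact: box_law_lt_Y].
Qed.

Lemma joint_df_ge0 r s : 0 <= joint_df X Y r s.
Proof. exact: fine_ge0. Qed.

Lemma joint_df_le1 r s : joint_df X Y r s <= 1.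
Proof.
have m : measurable (X @^-1` `]-oo, r] `&` Y @^-1` `]-oo, s]).
  by apply: measurableI; exact: measurable_preimage.
by rewrite -lee_fin fineK ?probability_le1// fin_num_measure.
Qed.

Lemma norm_joint_df4 r s : `|joint_df4 X Y r s| <= 4.
Proof.
rewrite ger0_norm ?addr_ge0 ?joint_df_ge0// (_ : 4 = 1 + 1 + 1 + 1); last by ring.
by rewrite !lerD ?joint_df_le1.
Qed.

(** The product of two [le_lt] expands into four quadrant indicators, one for each term of
    [joint_df4]. *)
Lemma box_law_le_lt_XY k l :
  box (fun k' l' => law X Y k' l' * (le_lt k k' * le_lt l l')) @ \oo -->
  joint_df4 X Y k%:R l%:R.
Proof.
have joint (r s : R) (b b' : nat -> bool) :
    (forall k', b k' = (k'%:R <= r)) -> (forall l', b' l' = (l'%:R <= s)) ->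
    box (fun k' l' => law X Y k' l' * ((b k')%:R * (b' l')%:R)) @ \oo -->
    joint_df X Y r s.
  move=> br bs; apply: (box_law_cvg
    (g := fun a b => (a <= r)%R%:R * (b <= s)%R%:R) (C := 1)).
  - by move=> *; rewrite normrM -[X in _ <= X]mulr1 ler_pM.
  - by move=> k' l'; rewrite br bs.
  - exact: expectation_joint_indic.
rewrite (@eq_box _ _ (fun k' l' =>
  law X Y k' l' * ((k' <= k)%N%:R * (l' <= l)%N%:R) +
  law X Y k' l' * ((k' < k)%N%:R * (l' <= l)%N%:R) +
  law X Y k' l' * ((k' <= k)%N%:R * (l' < l)%N%:R) +
  law X Y k' l' * ((k' < k)%N%:R * (l' < l)%N%:R))); last first.
  by move=> *; rewrite /le_lt; ring.
by do 3 ?apply: box_cvgD; apply: joint => *; rewrite ?le1_natr ?ler_nat.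
Qed.

Lemma box_law_df2_X : box (fun k l => law X Y k l * df2 X k%:R) @ \oo --> (1 : R).
Proof.
apply: (box_law_cvg (g := fun a _ => df2 X a) (C := 2)) => [*||].
- exact: norm_df2.
- by [].
- exact: expectation_df2.
Qed.

Lemma box_law_df2_Y : box (fun k l => law X Y k l * df2 Y l%:R) @ \oo --> (1 : R).
Proof.
apply: (box_law_cvg (g := fun _ b => df2 Y b) (C := 2)) => [*||].
- exact: norm_df2.
- by [].
- exact: expectation_df2.
Qed.

Let norm_df22 (X' Y' : {RV P >-> R}) a b : `|df2 X' a * df2 Y' b| <= 4.
Proof. by rewrite normrM (_ : 4 = 2 * 2) ?ler_pM ?norm_df2//; ring. Qed.

Lemma box_law_df2_XX :
  box (fun k l => law X Y k l * (df2 X k%:R * df2 X k%:R)) @ \oo --> 1 + S_moment X.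
Proof.
apply: (box_law_cvg (g := fun a _ => df2 X a * df2 X a) (C := 4)) => [*|//|].
- exact: norm_df22.
- exact: expectation_df2_sqr.
Qed.

Lemma box_law_df2_YY :
  box (fun k l => law X Y k l * (df2 Y l%:R * df2 Y l%:R)) @ \oo --> 1 + S_moment Y.
Proof.
apply: (box_law_cvg (g := fun _ b => df2 Y b * df2 Y b) (C := 4)) => [*|//|].
- exact: norm_df22.
- exact: expectation_df2_sqr.
Qed.

Lemma box_law_df2_XY :
  box (fun k l => law X Y k l * (df2 X k%:R * df2 Y l%:R)) @ \oo --> rho X Y / 3 + 1.
Proof.
apply: (box_law_cvg (g := fun a b => df2 X a * df2 Y b) (C := 4)) => [*|//|].
- exact: norm_df22.
- by rewrite /rho fine_expectation; field.
Qed.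

Lemma box_law_joint_df4 :
  box (fun k l => law X Y k l * joint_df4 X Y k%:R l%:R) @ \oo --> tau X Y + 1.
Proof.
apply: (box_law_cvg (g := fun a b => joint_df4 X Y a b) (C := 4)) => [*|//|].
- exact: norm_joint_df4.
- by rewrite /tau fine_expectation subrK.
Qed.

Section Coefficients.
Context {Z : Type} (F : set_system Z) {FF : Filter F}.
Variables (V : Z -> finType) (m : forall z, multigraph (V z)).
Arguments m : clear implicits.
Local Notation N z := (#|edge (m z)|%:R : R).
Hypothesis N_cvg : (fun z => (N z)^-1) @ F --> (0 : R).
Hypothesis N_gt0 : \forall z \near F, 0 < N z.
Variables a b : direction.
Local Notation x z := (source_deg a (m := m z)).
Local Notation y z := (target_deg b (m := m z)).
Hypothesis degs_cvg : forall k l, (fun z =>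
  emp (fun e : edge (m z) => ((x z e == k) && (y z e == l))%:R : R)) @ F -->
  law X Y k l.

Lemma kendall_cvg_tau : (fun z => kendall R (m z) a b) @ F --> tau X Y.
Proof.
rewrite -[tau X Y](addrK 1).
exact: (kendall_cvg N_cvg N_gt0 box_law_mass degs_cvg box_law_le_lt_XY
  box_law_joint_df4).
Qed.

(** The limiting variances are [S_moment X] and [S_moment Y], positive by non-degeneracy. *)
Lemma avg_spearman_cvg_rho : ~ degenerate X -> ~ degenerate Y ->
  (fun z => avg_spearman R (m z) a b) @ F -->
  rho X Y / (3 * Num.sqrt (S_moment X * S_moment Y)).
Proof.
move=> X_nondeg Y_nondeg.
have SX := S_moment_gt0 X_int X_ge0 X_nondeg.
have SY := S_moment_gt0 Y_int Y_ge0 Y_nondeg.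
have := avg_spearman_cvg N_cvg N_gt0 box_law_mass degs_cvg box_law_le_lt_X
  box_law_le_lt_Y box_law_df2_X box_law_df2_Y box_law_df2_XY box_law_df2_XX
  box_law_df2_YY.
rewrite !ltrDl !(addrC 1) !addrK => /(_ FF SX SY).
by rewrite -sqrtrM ?ltW// invfM mulrA.
Qed.

Lemma spearman_cvg_rho (u w : forall z, edge (m z) -> R) :
  (\forall z \near F, forall e : edge (m z), 0 <= u z e < 1) ->
  (\forall z \near F, forall e : edge (m z), 0 <= w z e < 1) ->
  (forall M (i j : 'I_M) k l, (fun z =>
     emp (fun e : edge (m z) => ((bin M (u z e) == i) && (bin M (w z e) == j))%:R *
       ((x z e == k) && (y z e == l))%:R : R)) @ F --> M%:R^-1 ^+ 2 * law X Y k l) ->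
  (fun z => spearman a b (u z) (w z)) @ F --> rho X Y.
Proof.
move=> u01 w01 bin_cvg.
have d01 (X' : {RV P >-> R}) r : 0 <= df X' r <= 1 by rewrite df_ge0 df_le1.
have dd01 (X' : {RV P >-> R}) r : 0 <= df X' r - df X' (r - 1) <= 1.
  have /andP[_ h1] := d01 X' r; have /andP[h2 _] := d01 X' (r - 1).
  have : df X' (r - 1) <= df X' r by apply: df_mono; rewrite gerBl.
  by move=> h; apply/andP; split; lra.
have bound (p q : R) : 0 <= p <= 1 -> 0 <= q <= 1 -> `|p * q| <= 1.
  move=> /andP[p0 p1] /andP[q0 q1].
  by rewrite ger0_norm ?mulr_ge0// -[X in _ <= X]mulr1 ler_pM.
have t01 (X' : {RV P >-> R}) r : 0 <= 1 - df X' r <= 1.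
  by have /andP[] := d01 X' r => *; apply/andP; split; lra.
pose tX r := 1 - df X r; pose tY r := 1 - df Y r.
pose gX r := df X r - df X (r - 1); pose gY r := df Y r - df Y (r - 1).
have gt_X k : box (fun k' l' => law X Y k' l' * (k < k')%N%:R) @ \oo --> tX k%:R.
  rewrite (@eq_box _ _ (fun k' l' => law X Y k' l' +
    -1 * (law X Y k' l' * (k' <= k)%N%:R))); last first.
    by move=> k' l'; rewrite ltnNge; case: (k' <= k)%N => /=; ring.
  rewrite /tX -[- df X _]mulN1r; apply: box_cvgD; first exact: box_law_mass.
  by apply: box_cvgZ; exact: box_law_le_X.
have gt_Y l : box (fun k' l' => law X Y k' l' * (l < l')%N%:R) @ \oo --> tY l%:R.
  rewrite (@eq_box _ _ (fun k' l' => law X Y k' l' +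
    -1 * (law X Y k' l' * (l' <= l)%N%:R))); last first.
    by move=> k' l'; rewrite ltnNge; case: (l' <= l)%N => /=; ring.
  rewrite /tY -[- df Y _]mulN1r; apply: box_cvgD; first exact: box_law_mass.
  by apply: box_cvgZ; exact: box_law_le_Y.
have eq_X k : box (fun k' l' => law X Y k' l' * (k' == k)%:R) @ \oo --> gX k%:R.
  rewrite (@eq_box _ _ (fun k' l' => law X Y k' l' * (k' <= k)%N%:R +
    -1 * (law X Y k' l' * (k' < k)%N%:R))); last first.
    by move=> k' l'; case: ltngtP => _ /=; ring.
  rewrite /gX -[- df X _]mulN1r; apply: box_cvgD; first exact: box_law_le_X.
  by apply: box_cvgZ; exact: box_law_lt_X.
have eq_Y l : box (fun k' l' => law X Y k' l' * (l' == l)%:R) @ \oo --> gY l%:R.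
  rewrite (@eq_box _ _ (fun k' l' => law X Y k' l' * (l' <= l)%N%:R +
    -1 * (law X Y k' l' * (l' < l)%N%:R))); last first.
    by move=> k' l'; case: ltngtP => _ /=; ring.
  rewrite /gY -[- df Y _]mulN1r; apply: box_cvgD; first exact: box_law_le_Y.
  by apply: box_cvgZ; exact: box_law_lt_Y.
have vcvg (g h : R -> R) : (forall r, 0 <= g r <= 1) -> (forall r, 0 <= h r <= 1) ->
    box (fun k l => law X Y k l * (g k%:R * h l%:R)) @ \oo -->
    \int[P]_t (g (X t) * h (Y t)).
  move=> g01 h01; apply: (box_law_cvg (g := fun a b => g a * h b) (C := 1)) => // *.
  exact: bound.
have v1 := vcvg tX tY (t01 X) (t01 Y).
have v2 := vcvg tX gY (t01 X) (dd01 Y).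
have v3 := vcvg gX tY (dd01 X) (t01 Y).
have v4 := vcvg gX gY (dd01 X) (dd01 Y).
have := cvg_emp_rank N_gt0 box_law_mass degs_cvg u01 w01 bin_cvg
  gt_X eq_X gt_Y eq_Y v1 v2 v3 v4.
set u1 := \int[P]_t _ in v1 *; set u2 := \int[P]_t _ in v2 *.
set u3 := \int[P]_t _ in v3 *; set u4 := \int[P]_t _ in v4 * => S_cvg.
(* Since [tX + gX / 2 = (2 - df2 X) / 2], and likewise for [Y], one sequence of box sums has both
   expressions as limits; uniqueness equates them. *)
have lim1 : box (fun k l => 4^-1 * (law X Y k l *
    ((2 - df2 X k%:R) * (2 - df2 Y l%:R)))) @ \oo --> 4^-1 * (rho X Y / 3 + 1).
  apply: box_cvgZ; apply: (@box_cvg_rank _ _ (fun k _ => df2 X k%:R)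
    (fun _ l => df2 Y l%:R) 0).
  - exact: box_law_mass.
  - exact: box_law_df2_X.
  - exact: box_law_df2_Y.
  - exact: box_law_df2_XY.
have lim2 : box (fun k l => 4^-1 * (law X Y k l *
    ((2 - df2 X k%:R) * (2 - df2 Y l%:R)))) @ \oo --> u1 + u2 / 2 + u3 / 2 + u4 / 4.
  rewrite ![_ / _]mulrC -!addrA.
  rewrite (@eq_box _ _ (fun k l => law X Y k l * (tX k%:R * tY l%:R) +
    (2^-1 * (law X Y k l * (tX k%:R * gY l%:R)) +
     (2^-1 * (law X Y k l * (gX k%:R * tY l%:R)) +
      4^-1 * (law X Y k l * (gX k%:R * gY l%:R)))))); last first.
    by move=> k l; rewrite /tX /tY /gX /gY /df2; field.
  by do !(apply: box_cvgD || apply: box_cvgZ);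
    [exact: v1|exact: v2|exact: v3|exact: v4].
have -> : rho X Y = 12 * (u1 + u2 / 2 + u3 / 2 + u4 / 4) - 3.
  rewrite -(cvg_lim (@norm_hausdorff _ _) lim2) (cvg_lim (@norm_hausdorff _ _) lim1).
  by field.
exact: (spearman_cvg N_cvg N_gt0 (S_cvg FF)).
Qed.

End Coefficients.
End DegreeLaw.

(** * Convergence with high probability *)

Lemma cvge0_le (R : realType) (f g : nat -> \bar R) :
  (forall n, (0 <= f n <= g n)%E) -> g @ \oo --> 0%E -> f @ \oo --> 0%E.
Proof.
move=> fg g0; apply: (@squeeze_cvge _ _ _ _ (cst 0%E) f g) => //.
  exact: nearW.
exact: cvg_cst.
Qed.

Section HighProbability.
Variables (R : realType) (d : nat -> measure_display).
Variables (T : forall n, measurableType (d n)).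
Variables (P : forall n, probability (T n) R).
Local Notation Z := {n & T n}.

(* For measurable functions on varying probability spaces, convergence in
   probability is convergence along this filter. *)
Definition whp : set_system Z := fun A => exists B : forall n, set (T n),
  [/\ forall n, measurable (B n), forall n t, ~ B n t -> A (existT _ n t) &
      (fun n => P n (B n)) @ \oo --> 0%E].

(** Properness, on which uniqueness of limits along [whp] rests, holds because sets filling every
    space have probability 1 and cannot be exceptional. *)
Global Instance whp_filter : ProperFilter whp.
Proof.
split; last split.
- move=> [B [mB BF B0]].
  have B1 n : P n (B n) = 1%E.
    suff -> : B n = setT by exact: probability_setT.
    by apply/seteqP; split => // t _; apply: contrapT => /BF.
  suff : (1 : \bar R)%E = 0%E by move=> /eqP; rewrite eqe oner_eq0.
  rewrite -(cvg_lim (@ereal_hausdorff R) B0) (funext B1) lim_cst//.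
- exists (fun _ => set0); split => //; under eq_fun do rewrite measure0.
  exact: cvg_cst.
- move=> A A' [B [mB BA B0]] [B' [mB' BA' B0']].
  exists (fun n => B n `|` B' n); split=> [n|n t|]; first exact: measurableU.
    by move=> /not_orP[/BA ? /BA' ?]; split.
  apply: (@cvge0_le _ _ (fun n => P n (B n) + P n (B' n))%E).
    by move=> n; rewrite measure_ge0/= measureU2.
  by rewrite -[X in _ --> X](adde0 0%E); apply: cvgeD.
- by move=> A A' AA' [B [mB BA B0]]; exists B; split => // n t /BA /AA'.
Qed.

Lemma cvg_in_probability_whp (X : forall n, T n -> R) (c : R) :
  (forall n, measurable_fun setT (X n)) -> cvg_in_probability P X c ->
  (fun z => X (tag z) (tagged z)) @ whp --> c.
Proof.
move=> mX Xc; apply/cvgrPdist_le => eps eps0.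
exists (fun n => [set t | eps < `|X n t - c|]); split.
- move=> n; rewrite -[X in measurable X]setTI.
  apply: (measurable_fun_ltr (f := cst eps) (g := fun t => `|X n t - c|)) => //.
  apply: measurableT_comp; first exact: normr_measurable.
  exact: measurable_funB.
- by move=> n t /negP; rewrite -leNgt distrC.
- exact: Xc.
Qed.

Lemma whp_cvg_in_probability (X : forall n, T n -> R) (c : R) :
  (forall n, measurable_fun setT (X n)) ->
  (fun z => X (tag z) (tagged z)) @ whp --> c -> cvg_in_probability P X c.
Proof.
move=> mX Xc eps eps0.
have /cvgrPdist_le/(_ _ eps0)[B [mB BX B0]] := Xc.
apply: cvge0_le B0 => n; rewrite measure_ge0/= le_measure ?inE//.
  rewrite -[X in measurable X]setTI.
  apply: (measurable_fun_ltr (f := cst eps) (g := fun t => `|X n t - c|)) => //.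
  apply: measurableT_comp; first exact: normr_measurable.
  exact: measurable_funB.
move=> t /=; apply: contraPP => /BX /=; rewrite distrC => h.
by apply/negP; rewrite -leNgt.
Qed.

Lemma whp_ae (Q : forall n, T n -> Prop) : (forall n, {ae P n, forall t, Q n t}) ->
  \forall z \near whp, Q (tag z) (tagged z).
Proof.
move=> Q_ae; pose B n := sval (cid (Q_ae n)).
have BP n : [/\ measurable (B n), P n (B n) = 0%E & ~` [set t | Q n t] `<=` B n].
  exact: (svalP (cid (Q_ae n))).
exists B; split=> [n|n t|]; first by have [] := BP n.
  by apply: contra_notP => nQ; have [_ _] := BP n; apply.
rewrite (_ : (fun _ => _) = cst 0%E); first exact: cvg_cst.
by apply/funext => n; have [] := BP n.
Qed.

(** The deviation from [c] is at most [eps / 2] off the exceptional set and at most [|c| + C] on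
    it. *)
Lemma whp_expectation (X : forall n, T n -> R) (c C : R) :
  (forall n, measurable_fun setT (X n)) -> (forall n t, `|X n t| <= C) ->
  (fun z => X (tag z) (tagged z)) @ whp --> c ->
  (fun n => 'E_(P n)[X n])%E @ \oo --> c%:E.
Proof.
move=> mX XC Xc.
have iX n : (P n).-integrable setT (EFin \o X n) by exact: bounded_integrable.
have -> : (fun n => 'E_(P n)[X n])%E = EFin \o (fun n => \int[P n]_t X n t).
  apply/funext => n; rewrite /= -fine_expectation fineK// unlock.
  exact: integrable_fin_num.
apply: cvg_EFin; first exact: nearW.
apply/cvgrPdist_le => eps eps0.
have eps2 : 0 < eps / 2 by rewrite divr_gt0.
have /cvgrPdist_le/(_ _ eps2)[B [mB BX B0]] := Xc.
have C0 : 0 <= C.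
  have [[n t] _] := @filter_ex _ whp _ _ filterT.
  exact: le_trans (XC n t).
have bound n : `|c - \int[P n]_t X n t| <=
    eps / 2 + (`|c| + C) * fine (P n (B n)).
  have ic : (P n).-integrable setT (EFin \o cst c).
    by apply: (@bounded_integrable _ _ _ _ _ `|c|).
  have iB : (P n).-integrable setT (EFin \o (fun t => (`|c| + C) * \1_(B n) t)).
    apply: (@bounded_integrable _ _ _ _ _ (`|c| + C)).
      by apply: measurable_funM => //; exact: measurable_indic.
    move=> t; rewrite indicE; case: (_ \in _); rewrite ?mulr1 ?mulr0 ?normr0 ?addr_ge0//.
    by rewrite ger0_norm ?addr_ge0.
  rewrite -{1}[c](Rintegral_const (P n)).
  rewrite -RintegralB//.
  have icX : (P n).-integrable setT (EFin \o (fun t => c - X n t)).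
    apply: (@bounded_integrable _ _ _ _ _ (`|c| + C)); first exact: measurable_funB.
    by move=> t; rewrite (le_trans (ler_normB _ _))// lerD2l.
  rewrite (le_trans (le_normr_Rintegral _ icX))//.
  have ieps : (P n).-integrable setT (EFin \o (fun t => eps / 2)).
    by apply: (@bounded_integrable _ _ _ _ _ `|eps / 2|).
  rewrite -(Rintegral_indic (P n) (mB n)) -RintegralZl//; last first.
    exact: integrable_indic.
  rewrite -[X in _ <= X + _](Rintegral_const (P n)).
  rewrite -RintegralD//; apply: le_Rintegral => //.
  - by apply: integrable_norm.
  - exact: (integrableD measurableT ieps iB).
  move=> t _; rewrite indicE; have [Bt|Bt] := pselect (B n t).
    rewrite mem_set// mulr1 (le_trans (ler_normB _ _))//.
    by rewrite (le_trans (_ : _ <= `|c| + C)) ?lerD2l// lerDr ltW.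
  by rewrite memNset// mulr0 addr0; exact: (BX n t Bt).
have : (fun n => eps / 2 + (`|c| + C) * fine (P n (B n))) @ \oo -->
    eps / 2 + (`|c| + C) * 0.
  apply: cvgD; first exact: cvg_cst.
  apply: cvgM; first exact: cvg_cst.
  exact: fine_cvg.
rewrite mulr0 addr0 => /cvgrPdist_le/(_ _ eps2).
apply: filterS => n /=; have := bound n.
move: (\int[P n]_t X n t) (_ * fine _) => y q.
rewrite !ler_norml => /andP[? ?] /andP[? ?]; apply/andP; split; lra.
Qed.

End HighProbability.

(** * Conditioning on the graph *)

Section GraphMeasurability.
Context d (T : measurableType d) (R : realType) (P : probability T R).
Variables (V : finType) (G : V * V -> {RV P >-> nat}).

Definition graph_atom (g : multigraph V) : set T := [set t | forall e, G e t = g e].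

Lemma measurable_graph_atom g : measurable (graph_atom g).
Proof.
rewrite (_ : graph_atom g = \bigcap_(e in [set: V * V]) G e @^-1` [set g e]).
  apply: fin_bigcap_measurable => [|e _]; first exact: finite_finset.
  by rewrite -[_ @^-1` _]setTI; exact: measurable_funP.
by apply/seteqP; split => t /= h e; [move=> _; exact: h|exact: h].
Qed.

Lemma realization_atom g t : graph_atom g t -> realization G t = g.
Proof. by move=> h; apply/funext. Qed.

(** The space is a countable union of atoms, multigraphs being encoded as finite functions into
    [nat]. On each atom the graph, and with it the type [edge], is fixed. *)
Lemma measurable_on_atoms (f : multigraph V -> T -> R) :
  (forall g, measurable_fun setT (f g)) ->
  measurable_fun setT (fun t => f (realization G t) t).
Proof.
move=> mf _ B mB; rewrite setTI.
rewrite (_ : _ @^-1` _ = \bigcup_(g in [set: {ffun V * V -> nat}])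
    (graph_atom g `&` f g @^-1` B)).
  apply: countable_bigcupT_measurable => [|g]; first exact: countableP.
  apply: measurableI; first exact: measurable_graph_atom.
  by rewrite -[_ @^-1` _]setTI; exact: mf.
apply/seteqP; split => [t /= Bt|t /= [g _ [/realization_atom <-]]//].
exists [ffun e => G e t] => //; split; first by move=> e; rewrite ffunE.
rewrite /= (_ : ([ffun e => G e t] : _ -> _) = realization G t)//.
by apply/funext => e; rewrite ffunE.
Qed.

Lemma measurable_graph (f : multigraph V -> R) :
  measurable_fun setT (fun t => f (realization G t)).
Proof. exact: (measurable_on_atoms (f := fun g _ => f g)). Qed.

Lemma ae_countable (I : countType) (Q : I -> T -> Prop) :
  (forall i, {ae P, forall t, Q i t}) -> {ae P, forall t, forall i, Q i t}.
Proof.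
move=> Q_ae; have : {ae P, forall t n, if unpickle n is Some i then Q i t else True}.
  apply: ae_foralln => n; case: (unpickle n) => [i|]; first exact: Q_ae.
  exact: aeW.
by apply: filterS => t h i; have := h (pickle i); rewrite pickleK.
Qed.

(** Total probability over the atoms. They are enumerated through the codes of multigraphs, with the
    empty set at integers that are not codes. *)
Lemma le_on_atoms (A : set T) (c : R) : measurable A -> 0 <= c ->
  (forall g, (P (A `&` graph_atom g) <= c%:E * P (graph_atom g))%E) ->
  (P A <= c%:E)%E.
Proof.
move=> mA c0 Ac.
pose C n := if @pickle_inv {ffun V * V -> nat} n is Some g then graph_atom g else set0.
have mC n : measurable (C n).
  by rewrite /C; case: pickle_inv => // g; exact: measurable_graph_atom.
have trivC : trivIset setT C.
  apply/trivIsetP => i j _ _ ij; apply/seteqP; split => // t [].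
  rewrite /C; have := @pickle_invK {ffun V * V -> nat} i.
  have := @pickle_invK {ffun V * V -> nat} j.
  case: pickle_inv => [g'|]//=; case: pickle_inv => [g|]//= g'j gi tg tg'.
  move: ij; rewrite -g'j -gi (_ : g = g') ?eqxx//.
  by apply/ffunP => e; rewrite -(tg e) (tg' e).
have cupC : \bigcup_n C n = setT.
  apply/seteqP; split => // t _; exists (pickle [ffun e => G e t]) => //.
  by rewrite /C pickleK_inv => e; rewrite ffunE.
have AC n : (P (A `&` C n) <= c%:E * P (C n))%E.
  by rewrite /C; case: pickle_inv => //; rewrite ?setI0 ?measure0 ?mule0.
rewrite -[A]setIT -cupC setI_bigcupr measure_bigcup//; last 2 first.
- by move=> i _; exact: measurableI.
- exact: trivIset_setIl.
apply: (@le_trans _ _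
  (\big[+%E/0%E]_(0 <= i <oo | i \in [set: nat]) (c%:E * P (C i)))%E).
  apply: lee_nneseries => [*|*]; [exact: measure_ge0|exact: AC].
rewrite nneseriesZl// -measure_bigcup// cupC.
rewrite -[leRHS]mule1; apply: lee_wpmul2l; first by rewrite lee_fin.
exact: probability_le1.
Qed.

Lemma emp_edges (m : multigraph V) (f : V * V -> R) :
  emp (fun e : edge m => f (tag e)) = \sum_x f x * ((m x)%:R / #|edge m|%:R).
Proof.
rewrite /emp mulr_suml.
rewrite -(sig_big_dep (fun _ => true) (fun _ _ => true)
  (fun x (_ : 'I_(m x)) => f x / #|edge m|%:R))/=.
by apply: eq_bigr => x _; rewrite sumr_cst card_ord; ring.
Qed.

(** On an atom the two degrees are functions of the sampled pair alone. Splitting by its value [x]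
    brings in the weights [G x t / |E|], by which [emp_edges] also expresses the mean over edges. *)
Lemma cond_expectation_emp (e : T -> V * V) a b (h : R * R -> R) :
  uniform_edge G e ->
  {ae P, forall t, (0 < nb_edges (realization G t))%N ->
    cond_expectation G (h \o end_degs G a b e) t =
    emp (fun f : edge (realization G t) =>
      h ((source_deg a f)%:R, (target_deg b f)%:R))}.
Proof.
move=> [me law_e]; apply: filterS law_e => t.
set m := realization G t => law_e /law_e {}law_e.
have mS := measurable_graph_atom m.
pose c (x : V * V) : R := h ((deg m a x.1)%:R, (deg m b x.2)%:R).
rewrite (emp_edges m c) -nb_edgesE /cond_expectation -[same_graph G t]/(graph_atom m).
have int_c x : P.-integrable setT (EFin \o (fun t => c x * \1_(e @^-1` [set x]) t)).
  apply: (@bounded_integrable _ _ _ _ _ `|c x|).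
    by apply: measurable_funM => //; exact: measurable_indic.
  by move=> s; rewrite indicE; case: (_ \in _); rewrite ?mulr1 ?mulr0 ?normr0.
rewrite -[X in X / _]/(\int[P]_(t' in graph_atom m) h (end_degs G a b e t'))%R.
have -> : \int[P]_(t' in graph_atom m) h (end_degs G a b e t') =
    \sum_x c x * fine (P (e @^-1` [set x] `&` graph_atom m)).
  transitivity (\int[P]_(t' in graph_atom m)
      \sum_x c x * \1_(e @^-1` [set x]) t').
    apply: eq_Rintegral => s; rewrite inE => /realization_atom sm.
    rewrite (bigD1 (e s))//= big1 ?addr0.
      by rewrite indicE mem_set// mulr1 /c /end_degs sm.
    by move=> x xe; rewrite indicE memNset ?mulr0//= => ex; rewrite ex eqxx in xe.
  rewrite Rintegral_sum//; last by move=> x; exact: integrableS (int_c x).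
  apply: eq_bigr => x _; rewrite RintegralZl//; last first.
    apply: integrableS (integrable_indic P (me x)) => //.
  by rewrite /Rintegral integral_indic.
rewrite mulr_suml; apply: eq_bigr => x _; rewrite -mulrA; congr (_ * _).
by rewrite -law_e.
Qed.

Lemma measurable_cond_expectation (X : T -> R) :
  measurable_fun setT (cond_expectation G X).
Proof.
exact: (measurable_graph (fun m =>
  fine (\int[P]_(t' in graph_atom m) (X t')%:E)%E / fine (P (graph_atom m)))).
Qed.

End GraphMeasurability.

(** * A weak law for the tie-breakers *)

Section UniformBins.
Context {R : realType}.

Lemma measurable_bin M i : measurable [set r : R | bin M r = i].
Proof.
have le_bin n : measurable [set r : R | (bin M r <= n)%N].
  rewrite -[X in measurable X]setTI.
  rewrite (_ : [set r | _] = [set r : R | M%:R * r < n.+1%:R]).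
    apply: (measurable_fun_ltr (f := fun r : R => M%:R * r) (g := cst n.+1%:R)) => //.
    exact: measurable_funM.
  by apply/seteqP; split => r /=; rewrite /bin truncn_le_nat.
case: i => [|i].
  rewrite (_ : [set r | _] = [set r : R | (bin M r <= 0)%N])//.
  by apply/seteqP; split => r /=; rewrite leqn0; [move=> ->|move/eqP].
rewrite (_ : [set r | _] = [set r : R | (bin M r <= i.+1)%N] `\`
    [set r : R | (bin M r <= i)%N]); first exact: measurableD.
apply/seteqP; split => r /=; first by move=> ->; rewrite leqnn ltnn.
by move=> [le1 /negP]; rewrite -ltnNge => lt1; apply/eqP; rewrite eqn_leq le1.
Qed.

Lemma uniform_probE (A : set R) : measurable A ->
  uniform_prob (@ltr01 R) A = lebesgue_measure (A `&` `[0, 1]).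
Proof.
move=> mA; rewrite /uniform_prob integral_uniform_pdf.
rewrite (eq_integral (cst 1%E)); last first.
  move=> x; rewrite inE /= in_itv/= => -[_ x01].
  by rewrite /uniform_pdf x01 subr0 invr1.
by rewrite integral_cst ?mul1e//; exact: measurableI.
Qed.

Lemma uniform_prob_bin M (i : 'I_M) :
  uniform_prob (@ltr01 R) [set r | bin M r = i] = (M%:R^-1)%:E.
Proof.
have M0 : 0 < M%:R :> R by case: i => i iM; rewrite ltr0n (leq_ltn_trans _ iM).
rewrite uniform_probE; last exact: measurable_bin.
(* Intersecting with [[0, 1]] removes the negative numbers, which share cell 0; the point 1 has
   index [M] and lies in no cell. *)
rewrite (_ : _ `&` _ = `[i%:R / M%:R, i.+1%:R / M%:R[%classic).
  rewrite lebesgue_measure_itv/= lte_fin ltr_pM2r ?invr_gt0// ltr_nat ltnSn.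
  by rewrite -EFinB -mulrBl -natr1 addrAC subrr add0r mul1r.
apply/seteqP; split => r /=; rewrite !in_itv/= ler_pdivrMr// ltr_pdivlMr//.
  move=> [bi /andP[r0 _]]; have := truncn_eq; rewrite mulrC.
  have Mr0 : 0 <= M%:R * r by rewrite mulr_ge0// ltW.
  by move=> _; have /andP[] := truncn_itv Mr0; rewrite -/(bin M r) bi => -> ->.
move=> /andP[ir ri]; have r0 : 0 <= r.
  by rewrite -(pmulr_lge0 _ M0) (le_trans _ ir).
split.
  by apply/truncn_def; rewrite mulrC ir ri.
rewrite r0/= -(ler_pM2r M0) mul1r (le_trans (ltW ri))// ler_nat.
exact: ltn_ord.
Qed.

Lemma uniform_prob_01 : uniform_prob (@ltr01 R) `[0, 1[%classic = 1%E.
Proof.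
rewrite uniform_probE// setIidl.
  by rewrite lebesgue_measure_itv/= lte_fin ltr01 -EFinB subr0.
by move=> r /=; rewrite !in_itv/= => /andP[-> /ltW].
Qed.

End UniformBins.

Section WeakLaw.
Context d (T : measurableType d) (R : realType) (P : probability T R).
Variables (V : finType) (G : V * V -> {RV P >-> nat}).
Variables (U W : V * V * nat -> {RV P >-> R}).
Hypothesis ties : tie_breakers G U W.

Definition edge_index (m : multigraph V) (f : edge m) : V * V * nat :=
  (tag f, val (tagged f)).

(** Distinct edges thus use distinct tie-breakers. *)
Lemma edge_index_inj m : injective (@edge_index m).
Proof.
move=> [x i] [y j] [/= xy]; subst y => ij.
by congr existT; exact: val_inj.
Qed.

Lemma ties_ae01 (X : V * V * nat -> {RV P >-> R}) :
  (forall j A, measurable A -> distribution P (X j) A = uniform_prob (@ltr01 R) A) ->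
  {ae P, forall t, forall j, 0 <= X j t < 1}.
Proof.
move=> X_unif; apply: ae_countable => j.
exists (~` (X j @^-1` `[0, 1[)); split.
- by apply: measurableC; exact: measurable_preimage.
- rewrite probability_setC; last exact: measurable_preimage.
  rewrite -[X in (_ - X)%E]/(distribution P (X j) `[0, 1[%classic) X_unif//.
  by rewrite uniform_prob_01 subee.
- by move=> t /=; apply: contra_not; rewrite in_itv.
Qed.

Variables (M : nat) (i j : 'I_M).

Definition bin_event (k : V * V * nat) : set T :=
  [set t | bin M (U k t) = i /\ bin M (W k t) = j].

Lemma measurable_bin_event k : measurable (bin_event k).
Proof.
rewrite (_ : bin_event k = U k @^-1` [set r | bin M r = i] `&`
  W k @^-1` [set r | bin M r = j])//.
by apply: measurableI; apply: measurable_preimage; exact: measurable_bin.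
Qed.

Let A (g : multigraph V) (s : option (V * V * nat + V * V * nat)) : set T :=
  match s with
  | None => graph_atom G g
  | Some (inl k) => U k @^-1` [set r | bin M r = i]
  | Some (inr k) => W k @^-1` [set r | bin M r = j]
  end.

Let A_event g s : tie_breaking_events G U W s (A g s).
Proof.
case: s => [[k|k]|] /=.
- by exists [set r | bin M r = i]; [exact: measurable_bin|rewrite setTI].
- by exists [set r | bin M r = j]; [exact: measurable_bin|rewrite setTI].
- exists [set g] => //; rewrite setTI; apply/seteqP; split => t /=.
    by move=> <-.
  by move=> h; apply/funext.
Qed.

Let P_U k : P (U k @^-1` [set r | bin M r = i]) = (M%:R^-1)%:E.
Proof.
rewrite -(uniform_prob_bin i).
exact: (tie_breakers_uniform_source ties k (measurable_bin _ _)).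
Qed.

Let P_W k : P (W k @^-1` [set r | bin M r = j]) = (M%:R^-1)%:E.
Proof.
rewrite -(uniform_prob_bin j).
exact: (tie_breakers_uniform_target ties k (measurable_bin _ _)).
Qed.

Let q : R := M%:R^-1 ^+ 2.

Lemma P_bin_event1 g k :
  P (bin_event k `&` graph_atom G g) = (q%:E * P (graph_atom G g))%E.
Proof.
have := tie_breakers_independent ties (s := [:: None; Some (inl k); Some (inr k)])
  isT (fun s _ => A_event g s).
rewrite 3!big_cons big_nil /= P_U P_W mule1 -EFinM -expr2 muleC => <-.
congr (P _); apply/seteqP; split => t.
  by move=> [[Ui Wj] Gg] s /=; rewrite !inE => /or3P[]/eqP->.
move=> h; split; first split.
- by apply: (h (Some (inl k))); rewrite /= !inE eqxx orbT.
- by apply: (h (Some (inr k))); rewrite /= !inE eqxx !orbT.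
- by apply: (h None); rewrite /= !inE eqxx.
Qed.

(** Independence of five events, the graph and two tie-breakers per edge; [k != l] makes the list of
    their indices duplicate-free. *)
Lemma P_bin_event2 g k l : k != l ->
  P (bin_event k `&` bin_event l `&` graph_atom G g) =
  ((q ^+ 2)%:E * P (graph_atom G g))%E.
Proof.
move=> kl.
have inl_kl : Some (inl k) != Some (inl l) :> option (V * V * nat + V * V * nat).
  by apply: contra_neq kl => -[].
have := tie_breakers_independent ties
  (s := [:: None; Some (inl k); Some (inr k); Some (inl l); Some (inr l)])
  _ (fun s _ => A_event g s).
rewrite 5!big_cons big_nil /= !P_U !P_W mule1 -!EFinM.
rewrite (_ : _ * _ = q ^+ 2); last by rewrite /q; ring.
rewrite muleC => <-; last first.
  by rewrite !inE !negb_or inl_kl.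
congr (P _); apply/seteqP; split => t.
  by move=> [[[Uk Wk] [Ul Wl]] Gg] s /=; rewrite !inE => /or4P[||| /orP[]]/eqP->.
move=> h; split; first split; [split|split|].
- by apply: (h (Some (inl k))); rewrite /= !inE eqxx orbT.
- by apply: (h (Some (inr k))); rewrite /= !inE eqxx !orbT.
- by apply: (h (Some (inl l))); rewrite /= !inE eqxx !orbT.
- by apply: (h (Some (inr l))); rewrite /= !inE eqxx !orbT.
- by apply: (h None); rewrite /= !inE eqxx.
Qed.

Definition bin_dev (k : V * V * nat) (t : T) : R := \1_(bin_event k) t - q.

Lemma measurable_bin_dev k : measurable_fun setT (bin_dev k).
Proof.
apply: measurable_funB => //; apply: measurable_indic.
exact: measurable_bin_event.
Qed.

Let q01 : 0 <= q <= 1.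
Proof.
rewrite /q exprn_ge0 ?invr_ge0//= exprn_ile1// ?invr_ge0// invf_le1.
  by rewrite ler1n; case: i => i' /(leq_ltn_trans _); apply.
by rewrite ltr0n; case: i => i' /(leq_ltn_trans _); apply.
Qed.

Lemma norm_bin_dev_le1 k t : `|bin_dev k t| <= 1.
Proof.
have /andP[q0 q1] := q01; rewrite /bin_dev indicE ler_norml.
by case: (_ \in _) => /=; apply/andP; split; lra.
Qed.

Lemma norm_bin_devM_le1 k l t : `|bin_dev k t * bin_dev l t| <= 1.
Proof. by rewrite normrM -[leRHS]mulr1 ler_pM// norm_bin_dev_le1. Qed.

Lemma integrable_bin_devM k l :
  P.-integrable setT (EFin \o (fun t => bin_dev k t * bin_dev l t)).
Proof.
apply: (@bounded_integrable _ _ _ _ _ 1); last exact: norm_bin_devM_le1.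
by apply: measurable_funM; exact: measurable_bin_dev.
Qed.

(** Expanding the product leaves [q^2 - q^2 - q^2 + q^2] times the probability of the atom. *)
Lemma bin_dev_uncorrelated g k l : k != l ->
  \int[P]_(t in graph_atom G g) (bin_dev k t * bin_dev l t) = 0.
Proof.
move=> kl; have mS := measurable_graph_atom G g.
have int_ind c A' : measurable A' ->
    P.-integrable (graph_atom G g) (EFin \o (fun t => c * \1_A' t)).
  move=> mA; apply: (@integrableS _ _ _ _ setT) => //.
  apply: (@bounded_integrable _ _ _ _ _ `|c|).
    by apply: measurable_funM => //; exact: measurable_indic.
  by move=> t; rewrite indicE; case: (_ \in _); rewrite ?mulr1 ?mulr0 ?normr0.
have Rint_ind c A' : measurable A' ->
    \int[P]_(t in graph_atom G g) (c * \1_A' t) = c * fine (P (A' `&` graph_atom G g)).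
  move=> mA; rewrite RintegralZl//; last first.
    by apply: integrableS (integrable_indic P mA).
  by rewrite /Rintegral integral_indic.
have intD (f h : T -> R) : P.-integrable (graph_atom G g) (EFin \o f) ->
    P.-integrable (graph_atom G g) (EFin \o h) ->
    P.-integrable (graph_atom G g) (EFin \o (fun t => f t + h t)).
  by move=> intf inth; exact: (integrableD mS intf inth).
have mk := measurable_bin_event k; have ml := measurable_bin_event l.
have mkl := measurableI _ _ mk ml.
transitivity (\int[P]_(t in graph_atom G g)
    (1 * \1_(bin_event k `&` bin_event l) t +
     (- q * \1_(bin_event k) t + (- q * \1_(bin_event l) t + q ^+ 2 * \1_setT t)))).
  apply: eq_Rintegral => t _; rewrite /bin_dev !indicE in_setI in_setT.
  by case: (_ \in _); case: (_ \in _) => /=; ring.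
rewrite RintegralD ?Rint_ind//; last 2 first.
- exact: int_ind.
- by apply: (intD); [|apply: (intD)]; exact: int_ind.
rewrite RintegralD ?Rint_ind//; last 2 first.
- exact: int_ind.
- by apply: (intD); exact: int_ind.
rewrite RintegralD ?Rint_ind//; last 2 first.
- exact: int_ind.
- exact: int_ind.
rewrite P_bin_event2// !P_bin_event1 setTI !fineM ?fin_num_measure//=.
ring.
Qed.

Lemma bin_dev_variance g k :
  \int[P]_(t in graph_atom G g) (bin_dev k t * bin_dev k t) <=
  fine (P (graph_atom G g)).
Proof.
have mS := measurable_graph_atom G g.
rewrite -[leRHS]mul1r -Rintegral_cst//; apply: le_Rintegral => //.
- by apply: integrableS (integrable_bin_devM k k).
- apply: (@integrableS _ _ _ _ setT) => //.
  by apply: (@bounded_integrable _ _ _ _ _ 1) => // t; rewrite normr1.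
- by move=> t _; rewrite (le_trans (ler_norm _))// norm_bin_devM_le1.
Qed.

(** Only the diagonal survives, so the squared sum is of order [N] rather than [N^2]. The selection
    [c] is fixed once the graph is. *)
Lemma bin_dev_second_moment g (c : edge g -> bool) :
  \int[P]_(t in graph_atom G g)
    (\sum_(e : edge g) \sum_(f : edge g) ((c e)%:R * (c f)%:R) *
       (bin_dev (edge_index e) t * bin_dev (edge_index f) t)) <=
  #|edge g|%:R * fine (P (graph_atom G g)).
Proof.
have mS := measurable_graph_atom G g.
have int_term (e f : edge g) : P.-integrable (graph_atom G g)
    (EFin \o (fun t => ((c e)%:R * (c f)%:R) *
       (bin_dev (edge_index e) t * bin_dev (edge_index f) t))).
  apply: (@integrableS _ _ _ _ setT) => //.
  apply: (@bounded_integrable _ _ _ _ _ 1) => [|t].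
    apply: measurable_funM => //.
    by apply: measurable_funM; exact: measurable_bin_dev.
  rewrite -natrM mulnb; case: (_ && _); rewrite ?mul1r ?mul0r ?normr0//.
  exact: norm_bin_devM_le1.
rewrite Rintegral_sum//; last first.
  move=> e; rewrite (_ : _ \o _ = fun t => \sum_(f : edge g) (((c e)%:R * (c f)%:R) *
       (bin_dev (edge_index e) t * bin_dev (edge_index f) t))%:E)%E; last first.
    by apply/funext => t; rewrite /= sumEFin.
  by apply: integrable_sum => // f _; exact: int_term.
rewrite mulrC -sumr_cst; apply: ler_sum => e _.
rewrite Rintegral_sum// (bigD1 e)//= big1 ?addr0.
  rewrite RintegralZl//; last by apply: integrableS (integrable_bin_devM _ _).
  rewrite -natrM mulnb andbb; case: (c e); rewrite ?mul1r ?mul0r//.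
    exact: bin_dev_variance.
  exact: fine_ge0.
move=> f fe; rewrite RintegralZl//; last by apply: integrableS (integrable_bin_devM _ _).
rewrite bin_dev_uncorrelated ?mulr0// eq_sym.
by apply: contra_neq fe => /edge_index_inj.
Qed.

(** Markov's inequality on the atom for the squared sum, which is at least [(eps * N) ^+ 2] on the
    bad event. *)
Lemma bin_dev_chebyshev g (c : edge g -> bool) (eps : R) :
  0 < eps -> 0 < #|edge g|%:R :> R ->
  (P ([set t | (eps < `|emp (fun e : edge g => bin_dev (edge_index e) t * (c e)%:R)|)%R]
      `&` graph_atom G g) <=
   (eps ^+ 2 * #|edge g|%:R)^-1%:E * P (graph_atom G g))%E.
Proof.
move=> eps0 N0; have mS := measurable_graph_atom G g.
set bad := [set t | _]; set N := #|edge g|%:R in N0 *.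
have mZ : measurable_fun setT
    (fun t => emp (fun e : edge g => bin_dev (edge_index e) t * (c e)%:R)).
  apply: measurable_funM => //; apply: measurable_sum => e.
  by apply: measurable_funM => //; exact: measurable_bin_dev.
have mbad : measurable bad.
  rewrite -[X in measurable X]setTI.
  apply: (measurable_fun_ltr (f := cst eps)) => //.
  by apply: measurableT_comp => //; exact: normr_measurable.
have := bin_dev_second_moment c; rewrite -/N.
have int_bad : P.-integrable (graph_atom G g)
    (EFin \o (fun t => (eps * N) ^+ 2 * \1_bad t)).
  apply: (@integrableS _ _ _ _ setT) => //.
  apply: (@bounded_integrable _ _ _ _ _ ((eps * N) ^+ 2)).
    by apply: measurable_funM => //; exact: measurable_indic.
  move=> t; rewrite indicE; case: (_ \in _); rewrite ?mulr1 ?mulr0 ?normr0 ?sqr_ge0//.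
  by rewrite ger0_norm ?sqr_ge0.
set S := (X in Rintegral P _ X).
have int_S : P.-integrable (graph_atom G g) (EFin \o S).
  apply: (@integrableS _ _ _ _ setT) => //.
  apply: (@bounded_integrable _ _ _ _ _ (\sum_(e : edge g) \sum_(f : edge g) 1)) => [|t].
    do 2 (apply: measurable_sum => ?); apply: measurable_funM => //.
    by apply: measurable_funM; exact: measurable_bin_dev.
  do 2 (rewrite (le_trans (ler_norm_sum _ _ _))//; apply: ler_sum => ? _).
  rewrite -natrM mulnb; case: (_ && _); rewrite ?mul1r ?mul0r ?normr0//.
  exact: norm_bin_devM_le1.
have le_S t : (eps * N) ^+ 2 * \1_bad t <= S t.
  have -> : S t = (N * emp (fun e : edge g => bin_dev (edge_index e) t * (c e)%:R)) ^+ 2.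
    rewrite /emp mulrC divfK ?gt_eqF// expr2 mulr_suml /S.
    apply: eq_bigr => e _; rewrite mulr_sumr; apply: eq_bigr => f _; ring.
  rewrite indicE; have [bt|bt] := boolP (t \in bad); last by rewrite mulr0 sqr_ge0.
  move: bt; rewrite inE /bad /= mulr1 => /ltW.
  move: (emp _) => z epsz; rewrite !exprMn [leLHS]mulrC ler_wpM2l ?sqr_ge0//.
  by rewrite -[leRHS]real_normK ?num_real// lerXn2r ?nnegrE ?(ltW eps0).
have := le_Rintegral mS int_bad int_S (fun t _ => le_S t).
rewrite RintegralZl//; last by apply: integrableS (integrable_indic P mbad).
rewrite {1}/Rintegral integral_indic// => /le_trans h /h {h}.
have fineP (B : set T) : measurable B -> P B = (fine (P B))%:E.
  by move=> mB; rewrite fineK// fin_num_measure.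
rewrite [P (bad `&` _)]fineP; last exact: measurableI.
rewrite [P (graph_atom G g)]fineP// -EFinM lee_fin /=.
move: (fine _) (fine _) => x y h.
have e0 : eps != 0 by rewrite gt_eqF.
have n0 : N != 0 by rewrite gt_eqF.
rewrite -(ler_pM2l (_ : 0 < (eps * N) ^+ 2)); last by rewrite exprn_gt0// mulr_gt0.
by rewrite (le_trans h)// le_eqVlt; apply/orP; left; apply/eqP; field; rewrite n0 e0.
Qed.

Variable c : forall g : multigraph V, edge g -> bool.

Lemma measurable_bin_dev_mean : measurable_fun setT (fun t =>
  emp (fun e : edge (realization G t) => bin_dev (edge_index e) t * (c e)%:R)).
Proof.
apply: (@measurable_on_atoms _ _ _ _ _ G (fun g t =>
  emp (fun e : edge g => bin_dev (edge_index e) t * (c e)%:R))) => g.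
apply: measurable_funM => //; apply: measurable_sum => e.
by apply: measurable_funM => //; exact: measurable_bin_dev.
Qed.

(** Atoms with fewer than [K] edges miss the event; on the others [N >= K] makes the bound
    uniform. *)
Lemma weak_law (eps : R) (K : nat) : 0 < eps -> (0 < K)%N ->
  (P ([set t | eps < `|emp (fun e : edge (realization G t) =>
                            bin_dev (edge_index e) t * (c e)%:R)|]%R
      `&` [set t | (K <= nb_edges (realization G t))%N]) <=
   (eps ^+ 2 * K%:R)^-1%:E)%E.
Proof.
move=> eps0 K0.
have K0' : 0 < K%:R :> R by rewrite ltr0n.
have mbad : measurable [set t | eps < `|emp (fun e : edge (realization G t) =>
                            bin_dev (edge_index e) t * (c e)%:R)|]%R.
  rewrite -[X in measurable X]setTI.
  apply: (measurable_fun_ltr (f := cst eps)) => //.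
  apply: measurableT_comp; [exact: normr_measurable|exact: measurable_bin_dev_mean].
have mK : measurable [set t | (K <= nb_edges (realization G t))%N].
  have := measurable_graph G (fun m => (nb_edges m)%:R : R) measurableT
    (measurable_itv `[K%:R, +oo[).
  rewrite setTI; congr measurable; apply/seteqP; split => t /=.
    by rewrite in_itv/= andbT ler_nat.
  by rewrite in_itv/= andbT ler_nat.
apply: (@le_on_atoms _ _ _ _ _ G) => [||g].
- exact: measurableI.
- by rewrite invr_ge0 mulr_ge0// ?sqr_ge0.
have [Kg|gK] := leqP K #|edge g|; last first.
  rewrite [X in (P X <= _)%E](_ : _ = set0).
    by rewrite measure0 mule_ge0// lee_fin invr_ge0 mulr_ge0 ?sqr_ge0.
  apply/seteqP; split => t //= [[_ Kt] /realization_atom tg].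
  by move: Kt; rewrite tg nb_edgesE leqNgt gK.
have N0 : 0 < #|edge g|%:R :> R by rewrite ltr0n (leq_trans K0).
have := bin_dev_chebyshev (c (g := g)) eps0 N0.
set B := (X in P (X `&` _)) => cheb.
apply: (@le_trans _ _ (P (B `&` graph_atom G g))).
  apply: le_measure; rewrite ?inE.
  - by apply: measurableI; [exact: measurableI|exact: measurable_graph_atom].
  - apply: measurableI; last exact: measurable_graph_atom.
    rewrite -[X in measurable X]setTI.
    apply: (measurable_fun_ltr (f := cst eps)) => //.
    apply: measurableT_comp; first exact: normr_measurable.
    apply: measurable_funM => //; apply: measurable_sum => e.
    by apply: measurable_funM => //; exact: measurable_bin_dev.
  - move=> t [[bt _] tg]; split => //; move: bt; rewrite /B /=.
    by rewrite (realization_atom tg).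
apply: (le_trans cheb); apply: lee_wpmul2r => //.
rewrite lee_fin lef_pV2 ?posrE ?mulr_gt0 ?exprn_gt0//.
by rewrite ler_pM2l ?exprn_gt0// ler_nat.
Qed.

End WeakLaw.

(** * Convergence of the degrees and conclusion *)

Section TestFunctions.
Context {R : realType}.

Definition pos_part (r : R) : R := (r + `|r|) / 2.

Lemma pos_part_continuous : continuous pos_part.
Proof.
move=> r; apply: cvgM; last exact: cvg_cst.
by apply: cvgD; [exact: cvg_id|apply: cvg_norm; exact: cvg_id].
Qed.

(** A tent of height 1 and half-width 1: continuous, yet for integral [c] an indicator on the
    integers. *)
Definition bump (c r : R) : R := pos_part (1 - `|r - c|).

Lemma bump_continuous c : continuous (bump c).
Proof.
move=> r; apply: (continuous_comp (f := fun r => 1 - `|r - c|)); last first.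
  exact: pos_part_continuous.
apply: cvgB; first exact: cvg_cst.
by apply: cvg_norm; apply: cvgB; [exact: cvg_id|exact: cvg_cst].
Qed.

Lemma norm_bump_le1 c r : `|bump c r| <= 1.
Proof.
rewrite /bump /pos_part; have := normr_ge0 (r - c); move: `|r - c| => s s0.
by case: (ger0P (1 - s)) => h; rewrite ler_norml; apply/andP; split; lra.
Qed.

Lemma bump_int (k : nat) (r : R) : r \is a Num.int -> bump k%:R r = (r == k%:R)%:R.
Proof.
move=> /intrP[i ->]; rewrite /bump /pos_part -[k%:R]/((k%:Z)%:~R).
rewrite -rmorphB/= -intr_norm eqr_int.
have [->|ik] := eqVneq i k; first by rewrite subrr normr0 subr0 normr1 /=; field.
have : 1 <= `|i - k%:Z| by lia.
rewrite -(ler_int R); move: (`|_ - _|%:~R) => s s1.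
by rewrite (ler0_norm (_ : 1 - s <= 0)) ?subr_le0//=; field.
Qed.

(** A ramp falling from 1 at -1 to 0 at 0, so on the integers it detects negativity. *)
Definition neg_step (r : R) : R := pos_part (- r) - pos_part (- r - 1).

Lemma neg_step_continuous : continuous neg_step.
Proof.
move=> r; apply: cvgB.
  apply: (continuous_comp (f := fun r => - r)); last exact: pos_part_continuous.
  exact: opp_continuous.
apply: (@continuous_comp _ _ _ (fun s : R => - s - 1) pos_part); last first.
  exact: pos_part_continuous.
by apply: cvgB; [exact: opp_continuous|exact: cvg_cst].
Qed.

Lemma norm_neg_step_le1 r : `|neg_step r| <= 1.
Proof.
rewrite /neg_step /pos_part.
by case: (ger0P (- r)) => h1; case: (ger0P (- r - 1)) => h2; rewrite ler_norml;
  apply/andP; split; lra.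
Qed.

Lemma neg_step_int (r : R) : r \is a Num.int -> neg_step r = (r < 0)%R%:R.
Proof.
move=> /intrP[i ->]; rewrite /neg_step /pos_part ltrz0.
have [i0|i0] := ltP i 0.
  have : i <= -1 by lia.
  rewrite -(ler_int R) => h; rewrite !ger0_norm /=; try lra.
have : 0 <= i%:~R :> R by rewrite ler0z.
by move=> h; rewrite !ler0_norm /=; lra.
Qed.

End TestFunctions.

(** * From the hypotheses to limits along the filter *)

Section Assembly.
Variables (R : realType) (a b : direction).
Variables (d : nat -> measure_display) (T : forall n, measurableType (d n)).
Variables (P : forall n, probability (T n) R) (V : nat -> finType).
Variables (G : forall n, V n * V n -> {RV (P n) >-> nat}).
Local Notation Z := {n & T n}.
Local Notation F := (whp P).
Local Notation graph z := (realization (G (n := tag z)) (tagged z)).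
Local Notation N z := (#|edge (graph z)|%:R : R).
Hypothesis nb_edges_cvg : cvg_pinfty_in_probability P
  (fun n t => nb_edges (realization (G (n := n)) t)).

Lemma measurable_nb_edges n K :
  measurable [set t | (K < nb_edges (realization (G (n := n)) t))%N].
Proof.
have := measurable_graph (G (n := n)) (fun m => (nb_edges m)%:R : R) measurableT
  (measurable_itv `]K%:R, +oo[).
by rewrite setTI; congr measurable; apply/seteqP; split => t /=;
  rewrite in_itv/= andbT ltr_nat.
Qed.

Lemma few_edges_cvg K : (fun n => P n
  (~` [set t | (K < nb_edges (realization (G (n := n)) t))%N])) @ \oo --> 0%E.
Proof.
rewrite (_ : (fun n => _) = (fun n => 1 - P n
    [set t | (K < nb_edges (realization (G (n := n)) t))%N])%E); last first.
  by apply/funext => n; rewrite probability_setC//; exact: measurable_nb_edges.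
rewrite -[X in _ --> X](_ : (1 - 1)%E = 0%E); last by rewrite subee.
by apply: cvgeB => //; exact: cvg_cst.
Qed.

Lemma whp_nb_edges K : \forall z \near F, (K < #|edge (graph z)|)%N.
Proof.
exists (fun n => ~` [set t | (K < nb_edges (realization (G (n := n)) t))%N]).
split; last exact: few_edges_cvg.
- by move=> n; apply: measurableC; exact: measurable_nb_edges.
- by move=> n t /contrapT /=; rewrite nb_edgesE.
Qed.

Lemma whp_N_gt0 : \forall z \near F, 0 < N z.
Proof. by apply: filterS (whp_nb_edges 0) => z; rewrite ltr0n. Qed.

Lemma whp_invN : (fun z => (N z)^-1) @ F --> (0 : R).
Proof.
apply/cvgrPdist_le => eps eps0.
apply: filterS (whp_nb_edges (Num.truncn eps^-1)) => z Nz.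
rewrite sub0r normrN ger0_norm ?invr_ge0//.
have h : eps^-1 <= N z.
  by rewrite (le_trans (ltW (truncnS_gt _)))// ler_nat.
rewrite -[leRHS]invrK lef_pV2// posrE ?invr_gt0//.
by rewrite (lt_le_trans _ h)// invr_gt0.
Qed.

Variable e : forall n, T n -> V n * V n.
Hypothesis e_uniform : forall n, uniform_edge (G (n := n)) (e (n := n)).
Context d' (T' : measurableType d') (P' : probability T' R).
Variables Da Db : {RV P' >-> R}.
Hypothesis Da_int : integer_valued Da.
Hypothesis Db_int : integer_valued Db.
Hypothesis degs_cvg : forall h : R * R -> R, continuous h -> bounded_fun h ->
  cvg_in_probability P
    (fun n => cond_expectation (G (n := n)) (h \o end_degs (G (n := n)) a b (e (n := n))))
    (fine 'E_P'[fun t => h (Da t, Db t)]).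

(** Almost surely, as soon as there is an edge, the conditional expectation of the hypothesis is the
    mean over the edges. *)
Lemma whp_emp (g h : R -> R) : continuous g -> continuous h ->
  (forall r, `|g r| <= 1) -> (forall r, `|h r| <= 1) ->
  (fun z => emp (fun f : edge (graph z) =>
     g (source_deg a f)%:R * h (target_deg b f)%:R)) @ F -->
  \int[P']_t (g (Da t) * h (Db t)).
Proof.
move=> g_cont h_cont g1 h1; pose gh (p : R * R) := g p.1 * h p.2.
have gh_cont : continuous gh.
  move=> p; apply: cvgM.
    by apply: (continuous_comp (f := fst)); [exact: cvg_fst|exact: g_cont].
  by apply: (continuous_comp (f := snd)); [exact: cvg_snd|exact: h_cont].
have gh_bounded : bounded_fun gh.
  exists 1; split => // y y1 p _; apply: le_trans (ltW y1).
  by rewrite normrM -[leRHS]mulr1 ler_pM.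
rewrite -fine_expectation.
apply: near_cvg (cvg_in_probability_whp _ (degs_cvg gh_cont gh_bounded)); last first.
  by move=> n; exact: measurable_cond_expectation.
have := whp_ae (fun n => cond_expectation_emp a b gh (e_uniform n)).
by apply: filterS2 (whp_nb_edges 0) => z; rewrite -nb_edgesE => N0 /(_ N0).
Qed.

Let one_continuous : continuous (fun _ : R => 1 : R).
Proof. by move=> r; exact: cvg_cst. Qed.

Let norm_one_le1 (r : R) : `|1 : R| <= 1.
Proof. by rewrite normr1. Qed.

Lemma neg_null (Y : {RV P' >-> R}) : integer_valued Y ->
  \int[P']_t neg_step (Y t) = 0 -> P' [set t | Y t < 0] = 0%E.
Proof.
move=> Y_int; under eq_Rintegral do rewrite neg_step_int//.
rewrite (_ : (fun t => _) = \1_[set t | Y t < 0]); last first.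
  apply/funext => t; rewrite indicE; congr (nat_of_bool _)%:R.
  by apply/idP/idP; rewrite inE.
have mY := measurable_lt0 Y.
by rewrite Rintegral_indic// => Y0; rewrite -[LHS]fineK ?Y0// fin_num_measure.
Qed.

(** Degrees are natural numbers, so all empirical means of [neg_step] are 0, and hence their limit
    is. *)
Lemma source_limit_ge0 : P' [set t | Da t < 0] = 0%E.
Proof.
apply: neg_null => //; apply/esym.
have lim := whp_emp neg_step_continuous one_continuous norm_neg_step_le1
  norm_one_le1.
have : (fun=> 0 : R) @ F --> \int[P']_t neg_step (Da t).
  under eq_Rintegral do rewrite -[neg_step _]mulr1.
  apply: near_cvg lim; apply: nearW => z; rewrite /emp big1 ?mul0r// => f _.
  by rewrite neg_step_int ?natr_int// ltrn0 mul0r.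
by move=> /(cvg_lim (@norm_hausdorff _ _)) <-; rewrite lim_cst.
Qed.

Lemma target_limit_ge0 : P' [set t | Db t < 0] = 0%E.
Proof.
apply: neg_null => //; apply/esym.
have lim := whp_emp one_continuous neg_step_continuous
  norm_one_le1 norm_neg_step_le1.
have : (fun=> 0 : R) @ F --> \int[P']_t neg_step (Db t).
  under eq_Rintegral do rewrite -[neg_step _]mul1r.
  apply: near_cvg lim; apply: nearW => z; rewrite /emp big1 ?mul0r// => f _.
  by rewrite neg_step_int ?natr_int// ltrn0 mulr0.
by move=> /(cvg_lim (@norm_hausdorff _ _)) <-; rewrite lim_cst.
Qed.

Lemma whp_law k l : (fun z => emp (fun f : edge (graph z) =>
    ((source_deg a f == k) && (target_deg b f == l))%:R : R)) @ F --> law Da Db k l.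
Proof.
have := whp_emp (@bump_continuous R k%:R) (@bump_continuous R l%:R)
  (norm_bump_le1 k%:R) (norm_bump_le1 l%:R).
rewrite (_ : \int[P']_t _ = law Da Db k l).
  apply: near_cvg; apply: nearW => z; congr emp; apply/funext => f.
  by rewrite !bump_int ?natr_int// !eqr_nat -natrM mulnb.
rewrite /law -Rintegral_indic; last first.
  by apply: measurableI; exact: measurable_preimage_set1.
apply: eq_Rintegral => t _; rewrite !bump_int// -natrM mulnb indicE.
congr (nat_of_bool _)%:R.
by apply/andP/idP; rewrite inE /= => -[] /eqP ? /eqP ?.
Qed.

Variables (U W : forall n, V n * V n * nat -> {RV (P n) >-> R}).
Hypothesis UW_ties : forall n, tie_breakers (G (n := n)) (U (n := n)) (W (n := n)).

Lemma whp_ties01 (X : forall n, V n * V n * nat -> {RV (P n) >-> R}) :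
  (forall n j A, measurable A ->
     distribution (P n) (X n j) A = uniform_prob (@ltr01 R) A) ->
  \forall z \near F, forall f : edge (graph z),
    0 <= at_edges (X (tag z)) f < 1.
Proof.
move=> X_unif.
have := whp_ae (fun n => ties_ae01 (X_unif n)).
by apply: filterS => z h f; exact: h.
Qed.

Lemma whp_bin_dev M (i j : 'I_M) (c : forall n (g : multigraph (V n)), edge g -> bool) :
  (fun z => emp (fun f : edge (graph z) =>
     bin_dev (U (n := tag z)) (W (n := tag z)) i j (edge_index f) (tagged z) *
     (c _ _ f)%:R)) @ F --> (0 : R).
Proof.
apply: (@cvg_in_probability_whp _ _ _ P (fun n t =>
  emp (fun f : edge (realization (G (n := n)) t) =>
     bin_dev (U (n := n)) (W (n := n)) i j (edge_index f) t * (c _ _ f)%:R))).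
  by move=> n; apply: measurable_bin_dev_mean.
move=> eps eps0; under eq_fun do under eq_set do rewrite subr0.
pose bad n := [set t | eps < `|emp (fun f : edge (realization (G (n := n)) t) =>
     bin_dev (U (n := n)) (W (n := n)) i j (edge_index f) t * (c _ _ f)%:R)|].
pose few K n := ~` [set t | (K < nb_edges (realization (G (n := n)) t))%N].
have mfew K n : measurable (few K n).
  by apply: measurableC; exact: measurable_nb_edges.
have mbad n : measurable (bad n).
  rewrite -[X in measurable X]setTI.
  apply: (measurable_fun_ltr (f := cst eps)) => //.
  apply: measurableT_comp; first exact: normr_measurable.
  apply: measurable_bin_dev_mean.
have bound K n : fine (P n (bad n)) <= fine (P n (few K n)) + (eps ^+ 2 * K.+1%:R)^-1.
  rewrite -lee_fin EFinD !fineK ?fin_num_measure//.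
  have := weak_law (UW_ties n) i j (c n) eps0 (ltn0Sn K).
  set A := _ `&` _ => PA.
  have mA : measurable A.
    apply: measurableI; first exact: mbad.
    exact: measurable_nb_edges.
  apply: (@le_trans _ _ (P n (few K n `|` A))).
    apply: le_measure; rewrite ?inE//; first exact: measurableU.
    move=> t bt; have [Kt|Kt] := leqP K.+1 (nb_edges (realization (G (n := n)) t)).
      by right; split.
    by left; apply/negP; rewrite -leqNgt.
  by rewrite (le_trans (measureU2 _ _ _))// leeD2l.
have fine0 : (fun n => fine (P n (bad n))) @ \oo --> (0 : R).
  apply/cvgrPdist_le => eta eta0.
  (* [K] is chosen first, to make the Chebyshev term at most [eta / 2]; the probability of at most
     [K] edges then vanishes as [n] grows. *)
  pose K := Num.truncn (eta / 2 * eps ^+ 2)^-1.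
  have K_eta : (eps ^+ 2 * K.+1%:R)^-1 <= eta / 2.
    have := truncnS_gt (eta / 2 * eps ^+ 2)^-1; rewrite -/K => h.
    have e2 : 0 < eps ^+ 2 by rewrite exprn_gt0.
    rewrite -[leRHS]invrK lef_pV2 ?posrE ?invr_gt0 ?divr_gt0 ?mulr_gt0//.
    by rewrite [leRHS]mulrC -ler_pdivrMr// -invfM ltW.
  have eta2 : 0 < eta / 2 by rewrite divr_gt0.
  have few0 : (fun n => fine (P n (few K n))) @ \oo --> (0 : R).
    exact: fine_cvg (few_edges_cvg K).
  have /cvgrPdist_le/(_ _ eta2) := few0.
  apply: filterS => n; rewrite !sub0r !normrN !ger0_norm ?fine_ge0//.
  move=> few_eta; rewrite (le_trans (bound K n))// [leRHS](splitr eta).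
  exact: lerD.
rewrite (_ : (fun n => _) = EFin \o (fun n => fine (P n (bad n)))).
  by apply: cvg_EFin => //; exact: nearW.
by apply/funext => n; rewrite /= fineK// fin_num_measure.
Qed.

(** An indicator of cells is its deviation, negligible by [whp_bin_dev], plus the constant
    [M%:R^-1 ^+ 2], which multiplies the empirical law. *)
Lemma whp_bins M (i j : 'I_M) k l : (fun z => emp (fun f : edge (graph z) =>
    ((bin M (at_edges (U (n := tag z)) f) == i) &&
     (bin M (at_edges (W (n := tag z)) f) == j))%:R *
    ((source_deg a f == k) && (target_deg b f == l))%:R : R)) @ F -->
  M%:R^-1 ^+ 2 * law Da Db k l.
Proof.
have dev := @whp_bin_dev M i j
  (fun n g f => (source_deg a f == k) && (target_deg b f == l)).
have lim : (fun z => M%:R^-1 ^+ 2 * emp (fun f : edge (graph z) =>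
    ((source_deg a f == k) && (target_deg b f == l))%:R : R)) @ F -->
    M%:R^-1 ^+ 2 * law Da Db k l.
  by apply: cvgM; [exact: cvg_cst|exact: (@whp_law k l)].
rewrite -[X in _ --> X]add0r; apply: near_cvg (cvgD dev lim); apply: nearW => z.
rewrite addrfctE; cbv beta; rewrite -empZ -empD; congr emp; apply/funext => f.
rewrite -mulrDl /bin_dev subrK indicE; congr ((nat_of_bool _)%:R * _).
by apply/idP/andP; rewrite inE /= => -[] /eqP ? /eqP ?.
Qed.

End Assembly.

(* The graph with index n has n + 1 vertices, so that a pair of vertices can
   always be sampled; all assertions concern the limit in n. *)
Theorem theorem4p3 (R : realType) (a b : direction)
    (d : nat -> measure_display) (T : forall n, measurableType (d n))
    (P : forall n, probability (T n) R)
    (V : nat -> finType) (card_V : forall n, #|V n| = n.+1)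
    (G : forall n, V n * V n -> {RV (P n) >-> nat})
    (e : forall n, T n -> V n * V n)
    (e_uniform : forall n, uniform_edge (G n) (e n))
    (U W : forall n, V n * V n * nat -> {RV (P n) >-> R})
    (UW_ties : forall n, tie_breakers (G n) (U n) (W n))
    (d' : measure_display) (T' : measurableType d') (P' : probability T' R)
    (Da Db : {RV P' >-> R})
    (Da_int : integer_valued Da) (Db_int : integer_valued Db)
    (Da_nondegenerate : ~ degenerate Da) (Db_nondegenerate : ~ degenerate Db)
    (degs_cvg : forall h : R * R -> R, continuous h -> bounded_fun h ->
       cvg_in_probability P
         (fun n => cond_expectation (G n) (h \o end_degs (G n) a b (e n)))
         (fine 'E_P'[fun t => h (Da t, Db t)]))
    (nb_edges_cvg : cvg_pinfty_in_probability P
       (fun n t => nb_edges (realization (G n) t))) :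
  [/\ cvg_in_probability P
        (fun n => random_spearman (G n) (U n) (W n) a b) (rho Da Db),
      cvg_in_probability P
        (fun n t => avg_spearman R (realization (G n) t) a b)
        (rho Da Db / (3 * Num.sqrt (S_moment Da * S_moment Db))) &
      cvg_in_probability P
        (fun n t => kendall R (realization (G n) t) a b) (tau Da Db)]
  /\
  [/\ (fun n => 'E_(P n)[random_spearman (G n) (U n) (W n) a b])%E @ \oo
        --> (rho Da Db)%:E,
      (fun n => 'E_(P n)[fun t => avg_spearman R (realization (G n) t) a b])%E
        @ \oo --> (rho Da Db / (3 * Num.sqrt (S_moment Da * S_moment Db)))%:E &
      (fun n => 'E_(P n)[fun t => kendall R (realization (G n) t) a b])%E @ \oo
        --> (tau Da Db)%:E].
Proof.
have Da_ge0 := source_limit_ge0 nb_edges_cvg e_uniform Da_int degs_cvg.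
have Db_ge0 := target_limit_ge0 nb_edges_cvg e_uniform Db_int degs_cvg.
have N_cvg := whp_invN nb_edges_cvg.
have N_gt0 := whp_N_gt0 nb_edges_cvg.
have degs := whp_law nb_edges_cvg e_uniform Da_int Db_int degs_cvg.
have kendall_whp := kendall_cvg_tau Da_int Db_int Da_ge0 Db_ge0 N_cvg N_gt0 degs.
have avg_whp := avg_spearman_cvg_rho Da_int Db_int Da_ge0 Db_ge0 N_cvg N_gt0 degs
  Da_nondegenerate Db_nondegenerate.
have rho_whp : (fun z => random_spearman (G (tag z)) (U (tag z)) (W (tag z)) a b
    (tagged z)) @ whp P --> rho Da Db.
  apply: (spearman_cvg_rho Da_int Db_int Da_ge0 Db_ge0 N_cvg N_gt0 degs).
  - by apply: whp_ties01 => n; exact: tie_breakers_uniform_source (UW_ties n).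
  - by apply: whp_ties01 => n; exact: tie_breakers_uniform_target (UW_ties n).
  - move=> M i j k l.
    exact: (whp_bins nb_edges_cvg e_uniform Da_int Db_int degs_cvg UW_ties).
(* The other two coefficients depend on the graph alone. This one also involves the tie-breakers,
   but on an atom it is a polynomial in indicators of comparisons between them. *)
have m_rho n : measurable_fun setT (random_spearman (G n) (U n) (W n) a b).
  apply: (@measurable_on_atoms _ _ _ _ _ (G n) (fun g t =>
    spearman a b (fun f : edge g => U n (edge_index f) t)
                 (fun f : edge g => W n (edge_index f) t))) => g.
  have m_rank (x : edge g -> nat) (X : V n * V n * nat -> {RV P n >-> R}) f :
      measurable_fun setT (fun t => rank x (fun f => X (edge_index f) t) f).
    apply: measurable_sum => f'.
    rewrite (_ : (fun t => _) = \1_[set t | ((x f)%:R + X (edge_index f) t <=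
        (x f')%:R + X (edge_index f') t)%R]).
      apply: measurable_indic; rewrite -[Y in measurable Y]setTI.
      by apply: measurable_fun_ler => //; exact: measurable_funD.
    apply/funext => t; rewrite indicE; congr (nat_of_bool _)%:R.
    by apply/idP/idP; rewrite inE.
  apply: measurable_funM => //; apply: measurable_funB => //.
  apply: measurable_funM => //; apply: measurable_sum => f.
  by apply: measurable_funM; exact: m_rank.
have m_avg n : measurable_fun setT
    (fun t => avg_spearman R (realization (G n) t) a b).
  exact: (measurable_graph (G n) (fun m => avg_spearman R m a b)).
have m_tau n : measurable_fun setT (fun t => kendall R (realization (G n) t) a b).
  exact: (measurable_graph (G n) (fun m => kendall R m a b)).
split; split.
- exact: whp_cvg_in_probability m_rho rho_whp.
- by apply: (whp_cvg_in_probability m_avg); exact: avg_whp.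
- by apply: (whp_cvg_in_probability m_tau); exact: kendall_whp.
- by apply: whp_expectation m_rho _ rho_whp => n t; exact: norm_spearman_le.
- apply: (whp_expectation m_avg (C := 1)); last exact: avg_whp.
  by move=> n t; exact: norm_avg_spearman_le1.
- apply: (whp_expectation m_tau (C := 6)); last exact: kendall_whp.
  by move=> n t; exact: norm_kendall_le.
Qed.
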